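(* Let $G$ be a contraction critically quasi $5$-connected graph with $|V(G)|\geq 14$. Suppose there is a vertex $x\in V_{4}(G)$ such that the subgraph of $G$ induced by the neighbourhood $N_{G}(x)$ is isomorphic to the cycle $C_{4}$. Then $G$ has a quasi $5$-contractible subgraph $H$ with at least one and at most three edges.
   Context: All graphs are finite, simple and undirected. $V_{k}(G)$ is the set of vertices of degree $k$ in $G$. A cut of a connected graph $G$ is a set $T\subseteq V(G)$ such that $G-T$ is disconnected; a $k$-cut is a cut with $k$ elements. A $k$-cut $T$ is nontrivial if the components of $G-T$ can be partitioned into two subgraphs $G_{1},G_{2}$ with $|V(G_{1})|\geq 2$ and $|V(G_{2})|\geq 2$. A graph is quasi $k$-connected if it is $(k-1)$-connected and has no nontrivial $(k-1)$-cut. Contracting an edge $e=xy$ means deleting it and identifying its ends, then replacing multiple edges by single edges; the result is $G/e$. Contracting a subgraph $H$ of $G$ means identifying the vertex set of each component of $H$ to a single vertex, removing resulting loops and replacing resulting multiple edges by single edges. A subgraph $H$ (in particular an edge) is quasi $5$-contractible if the graph obtained from $G$ by contracting $H$ is quasi $5$-connected. $G$ is contraction critically quasi $5$-connected if $G$ is quasi $5$-connected and no edge $e$ of $G$ is quasi $5$-contractible, i.e. $G/e$ is not quasi $5$-connected for every edge $e$. *)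

(* Defs.v *)
From mathcomp Require Import all_boot.

Set Implicit Arguments.
Unset Strict Implicit.
Unset Printing Implicit Defensive.

Record sgraph := SGraph {
  svertex :> finType;
  adj : rel svertex;
  adj_sym : symmetric adj;
  adj_irr : irreflexive adj }.

Section Basics.
Variable G : sgraph.

Definition nbhd (x : G) : {set G} := [set y | adj x y].
Definition deg (x : G) : nat := #|nbhd x|.
Definition Vdeg (k : nat) : {set G} := [set x | deg x == k].

Definition edges : {set {set G}} :=
  [set e : {set G} | [exists x, exists y, adj x y && (e == [set x; y])]].

(* The graph with no vertices counts as connected, so that [setT] is never
   a cut. *)
Definition connected : bool := [forall x : G, forall y : G, connect (@adj G) x y].

Definition components : {set {set G}} :=
  equivalence_partition (connect (@adj G)) [set: G].

Section Induced.
Variable S : {set G}.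

Definition induced_adj : rel {x : G | x \in S} :=
  [rel u v | adj (val u) (val v)].

Lemma induced_adj_sym : symmetric induced_adj.
Proof. by move=> u v; exact: adj_sym. Qed.

Lemma induced_adj_irr : irreflexive induced_adj.
Proof. by move=> u; exact: adj_irr. Qed.

Definition induced : sgraph := SGraph induced_adj_sym induced_adj_irr.
End Induced.
End Basics.

Definition delete (G : sgraph) (T : {set G}) : sgraph := induced (~: T).

Definition isomorphic (G H : sgraph) : Prop :=
  exists2 f : G -> H, bijective f & forall u v, adj (f u) (f v) = adj u v.

Section Cycle.
Variable n : nat.

(* The conjunct [i != j] only matters for [n = 1]; this is the cycle C_n
   for [3 <= n]. *)
Definition cycle_adj : rel 'I_n :=
  [rel i j | (i != j) && ((j == ordS i) || (i == ordS j))].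

Lemma cycle_adj_sym : symmetric cycle_adj.
Proof. by move=> i j; rewrite /cycle_adj /= eq_sym orbC. Qed.

Lemma cycle_adj_irr : irreflexive cycle_adj.
Proof. by move=> i; rewrite /cycle_adj /= eqxx. Qed.

Definition cycle_graph : sgraph := SGraph cycle_adj_sym cycle_adj_irr.
End Cycle.

Section Connectivity.
Variable G : sgraph.

Definition is_cut (T : {set G}) : bool := ~~ connected (delete T).

(* [P] and its complement form the partition of the components of G - T into
   the two subgraphs G_1 and G_2. *)
Definition nontrivial_cut (T : {set G}) : bool :=
  is_cut T &&
  [exists P : {set {set delete T}},
    [&& P \subset components (delete T),
        2 <= #|cover P| & 2 <= #|cover (components (delete T) :\: P)|]].

Definition k_connected (k : nat) : bool :=
  (k < #|G|) && [forall T : {set G}, is_cut T ==> (k <= #|T|)].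

Definition quasi_connected (k : nat) : bool :=
  k_connected k.-1 &&
  [forall T : {set G}, (#|T| == k.-1) ==> ~~ nontrivial_cut T].
End Connectivity.

Record subgraph (G : sgraph) := Subgraph {
  sub_vertices : {set G};
  sub_edges : {set {set G}};
  sub_edgesG : sub_edges \subset edges G;
  sub_edges_ends : forall e, e \in sub_edges -> e \subset sub_vertices }.

Section Contraction.
Variables (G : sgraph) (H : subgraph G).

Definition sub_adj : rel G := [rel x y | [set x; y] \in sub_edges H].

(* The vertex sets of the components of [H], together with the singletons of
   the vertices of [G] outside [H]. *)
Definition contract_classes : {set {set G}} :=
  equivalence_partition (connect sub_adj) [set: G].

Definition contract_vertex : finType := {B : {set G} | B \in contract_classes}.

Definition contract_adj : rel contract_vertex :=
  [rel A B : contract_vertex | (A != B) &&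
     [exists a in sval A, exists b in sval B, adj a b]].

Lemma contract_adj_sym : symmetric contract_adj.
Proof.
move=> A B; rewrite /contract_adj /= eq_sym; congr (_ && _).
by apply/exists_inP/exists_inP => -[a aA /exists_inP[b bB ab]];
  exists b => //; apply/exists_inP; exists a => //; rewrite adj_sym.
Qed.

Lemma contract_adj_irr : irreflexive contract_adj.
Proof. by move=> A; rewrite /contract_adj /= eqxx. Qed.

Definition contract : sgraph := SGraph contract_adj_sym contract_adj_irr.

Definition quasi_contractible (k : nat) : bool := quasi_connected contract k.
End Contraction.

Section EdgeContraction.
Variables (G : sgraph) (e : {set G}) (eG : e \in edges G).

Lemma edge_subgraph_edges : [set e] \subset edges G.
Proof. by rewrite sub1set. Qed.

Lemma edge_subgraph_ends (f : {set G}) : f \in [set e] -> f \subset e.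
Proof. by move=> /set1P ->. Qed.

Definition edge_subgraph : subgraph G :=
  Subgraph edge_subgraph_edges edge_subgraph_ends.
End EdgeContraction.

Definition contraction_critically_quasi_connected (G : sgraph) (k : nat) : Prop :=
  quasi_connected G k /\
  forall (e : {set G}) (eG : e \in edges G),
    ~~ quasi_contractible (edge_subgraph eG) k.

(* Main.v *)
Require Import Defs.
From mathcomp Require Import all_boot zify.

(** Let N(x) = {a, b, c, d} induce the 4-cycle abcd, and suppose that no
    subgraph with one to three edges is quasi 5-contractible.  Since xa is not
    contractible, G has a 5-cut through x, a, c separating b from d, and likewise
    one through x, b, d separating a from c.  Counting the four corners of this
    crossing, |G| >= 14 forces a side {b, t} of the first and a side {a, y} of the
    second, with t and y of degree 4: N(y) = {a, d, w, z}, N(t) = {b, c, u, v}.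
    A cut witnessing that the triangle xab is not contractible must then be
    {x, a, b, y, t, r} with a side {u, w} (after renaming), or with a side {c, d}.
    In the first case the edges yz and tv cannot both fail to be contractible;
    in the second one of ct and {bu, tv} is contractible.
    The case distinctions on where the named vertices lie with respect to a cut
    are made by a verified search, which discards a placement when moving a few
    named vertices between a side and the cut yields a cut that is too small. *)

Set Implicit Arguments.
Unset Strict Implicit.
Unset Printing Implicit Defensive.

(** * Separations *)

(** Everything rests on one inequality, [squeeze]: if all edges leaving a set X end in L and at
    least two vertices lie outside both, then |L| <= 4 leaves at most one vertex in X and |L| <= 3
    leaves none. A contraction can fail in two ways. A vertex of degree at most 3 in the contraction
    is excluded mostly because a, b, c, d have degree at least 5. Otherwise the contraction has a
    bad cut, and pulling it back gives a cut of G of at most 4 vertices plus the number of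
    contracted leaves in it: 5 for an edge, 6 for two edges. The triangle xab is contracted along
    its two edges at x, so it too gives 6. Such cuts do not contradict quasi 5-connectedness by
    themselves; they become contradictory only through vertices whose whole neighbourhood is named,
    and every stage of the proof aims at producing more of those. In [small_boundary] the constant
    14 reads 8 + 4 + 2: the case of the side {u, w} ends with the eight vertices x, a, b, y, t, u,
    w, r enclosed by c, d, v, z, and two vertices must remain outside. *)

Section Separations.
Variable G : sgraph.
Implicit Types (A B T X L : {set G}) (v w : G).

Lemma adj_connect_sym : connect_sym (@adj G).
Proof. by apply: sym_connect_sym => u v; apply: adj_sym. Qed.

Definition cut A B : {set G} := ~: (A :|: B).

Definition sep A B :=
  [disjoint A & B] && [forall v in A, forall w in B, ~~ adj v w].

Lemma sepP A B :
  reflect ([disjoint A & B] /\ forall v w, v \in A -> w \in B -> ~~ adj v w)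
          (sep A B).
Proof.
apply: (iffP andP) => -[dAB nAB]; split=> //.
  by move=> v w vA wB; move/forall_inP/(_ v vA)/forall_inP/(_ w wB): nAB.
by apply/forall_inP => v vA; apply/forall_inP => w wB; apply: nAB.
Qed.

Lemma sep_sym A B : sep A B = sep B A.
Proof.
apply/sepP/sepP=> -[dAB nAB]; rewrite disjoint_sym; split=> // v w vA wB;
  by rewrite adj_sym nAB.
Qed.

Lemma cut_sym A B : cut A B = cut B A.
Proof. by rewrite /cut setUC. Qed.

Lemma in_cut A B v : (v \in cut A B) = (v \notin A) && (v \notin B).
Proof. by rewrite !inE negb_or. Qed.

Lemma card_sep A B : sep A B -> #|A| + #|B| + #|cut A B| = #|G|.
Proof.
move=> /sepP[dAB _]; rewrite /cut -(cardsC (A :|: B)) cardsU.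
by move: dAB; rewrite -setI_eq0 => /eqP->; rewrite cards0 subn0.
Qed.

Lemma connect_delete_side A B (u v : delete (cut A B)) :
  sep A B -> val u \in A -> connect (@adj (delete (cut A B))) u v -> val v \in A.
Proof.
move=> /sepP[_ nAB] uA /connectP[p pth ->].
elim: p u uA pth => //= w p IHp u uA /andP[uw pth].
apply: IHp pth; have := valP w; rewrite !inE negbK => /orP[// | wB].
by case/negP: (nAB _ _ uA wB).
Qed.

Lemma sep_is_cut A B : sep A B -> 0 < #|A| -> 0 < #|B| -> is_cut (cut A B).
Proof.
move=> sAB /card_gt0P[a aA] /card_gt0P[b bB]; apply/negP => /forallP con.
have aD : a \in ~: cut A B by rewrite !inE negbK aA.
have bD : b \in ~: cut A B by rewrite !inE negbK bB orbT.
have /forallP/(_ (Sub b bD)) := con (Sub a aD).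
move/(connect_delete_side sAB)=> /= /(_ aA) bA.
by case/sepP: sAB => /pred0P/(_ b)/=; rewrite bA bB.
Qed.

Lemma is_cut_sep T : is_cut T ->
  exists A B, [/\ sep A B, 0 < #|A|, 0 < #|B| & cut A B = T].
Proof.
rewrite /is_cut /connected => /forallPn[u /forallPn[v ncuv]].
pose A := [set val w | w in [set w | connect (@adj (delete T)) u w]].
exists A, (~: (A :|: T)).
have AT w : w \in A -> w \notin T.
  by case/imsetP=> w' _ ->; have := valP w'; rewrite inE.
have inA (w : delete T) : (val w \in A) = connect (@adj (delete T)) u w.
  by rewrite mem_imset ?inE //; apply: val_inj.
split.
- apply/sepP; split.
    by rewrite -setI_eq0; apply/eqP/setP => w; rewrite !inE; case: (w \in A).
  move=> a b /imsetP[a']; rewrite inE => ua -> {a}; rewrite !inE negb_or.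
  case/andP=> bA bT; apply: contra bA => ab.
  have bD : b \in ~: T by rewrite inE.
  rewrite -[b]/(val (Sub b bD : delete T)) inA.
  by apply: connect_trans ua _; apply: connect1.
- by apply/card_gt0P; exists (val u); rewrite inA.
- apply/card_gt0P; exists (val v); rewrite !inE inA negb_or ncuv.
  by have := valP v; rewrite inE.
- apply/setP => w; rewrite in_cut !inE negbK.
  by case wA: (w \in A) => //=; apply/esym/negbTE/AT.
Qed.

Lemma components_partition : partition (components G) [set: G].
Proof.
apply: equivalence_partitionP => u v w _ _ _; split; first exact: connect0.
by move=> uv; apply: (same_connect adj_connect_sym uv).
Qed.

Lemma mem_component (C : {set G}) u v : C \in components G ->
  u \in C -> connect (@adj G) u v = (v \in C).
Proof.
case/imsetP=> w _ ->; rewrite !inE /= => wu.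
by rewrite (same_connect adj_connect_sym wu).
Qed.

Lemma cover_components : cover (components G) = [set: G].
Proof. by case/and3P: components_partition => /eqP. Qed.
End Separations.

Section Cuts.
Variable G : sgraph.
Implicit Types (A B T : {set G}).

(** Each component of the rest lies within one side, so the components contained in [A] cover
    exactly [A] and the remaining ones exactly [B]. *)
Lemma sep_nontrivial_cut A B :
  sep A B -> 1 < #|A| -> 1 < #|B| -> nontrivial_cut (cut A B).
Proof.
move=> sAB cA cB; rewrite /nontrivial_cut sep_is_cut // ?(ltnW cA, ltnW cB) //=.
set D := delete _.
have sideA (u v : D) : connect (@adj D) u v -> (val u \in A) = (val v \in A).
  move=> uv; apply/idP/idP => [uA|vA].
    exact: (connect_delete_side sAB uA uv).
  by apply: (connect_delete_side sAB vA); rewrite adj_connect_sym.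
have dAB v : v \in A -> v \notin B.
  by case/sepP: sAB => /pred0P/(_ v)/= + _ => /negbT; rewrite negb_and => /orP[/negP|].
pose P := [set C in components D | C \subset [set v | val v \in A]].
have memP C : (C \in P) = (C \in components D) && (C \subset [set v | val v \in A]).
  by rewrite inE.
have PA : cover P = [set v : D | val v \in A].
  apply/setP => v; apply/bigcupP/idP => [[C]|].
    by rewrite memP => /andP[_ /subsetP sC] /sC.
  rewrite inE => vA; have : v \in cover (components D) by rewrite cover_components inE.
  case/bigcupP=> C CD vC; exists C => //; rewrite memP CD; apply/subsetP => w wC.
  by rewrite inE -(sideA v) // (mem_component _ CD).
have PB : cover (components D :\: P) = [set v : D | val v \in B].
  apply/setP => v; have vAB : (val v \in B) = (val v \notin A).
    apply/idP/idP => [vB|vA]; first by apply: contraTN vB; apply: dAB.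
    by have := valP v; rewrite !inE negbK (negbTE vA).
  apply/bigcupP/idP => [[C]|].
    rewrite in_setD memP => /andP[nC CD] vC; rewrite inE vAB; apply: contra nC => vA.
    rewrite CD; apply/subsetP => w wC.
    by rewrite inE -(sideA v) // (mem_component _ CD).
  rewrite inE vAB => vA; have : v \in cover (components D) by rewrite cover_components inE.
  case/bigcupP=> C CD vC; exists C => //; rewrite in_setD memP CD andbT /=.
  by apply: contra vA => /subsetP/(_ v vC); rewrite inE.
have cardD (X : {set G}) : X \subset A :|: B -> #|[set v : D | val v \in X]| = #|X|.
  move=> sX; rewrite -(card_imset _ val_inj); apply: eq_card => v.
  apply/imsetP/idP => [[w + ->]|vX]; first by rewrite inE.
  have vD : v \in ~: cut A B by rewrite setCK (subsetP sX).
  by exists (Sub v vD); rewrite ?inE.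
apply/existsP; exists P; rewrite PA PB !cardD ?subsetUl ?subsetUr // cA cB !andbT.
by apply/subsetP => C; rewrite memP => /andP[].
Qed.

Lemma nontrivial_cut_sep T : nontrivial_cut T ->
  exists A B, [/\ sep A B, 1 < #|A|, 1 < #|B| & cut A B = T].
Proof.
case/andP=> _ /existsP[P /and3P[PC cP cQ]].
set Q := _ :\: P in cQ; set D := delete T in P PC cP Q cQ.
have memPQ (v : D) : (v \in cover P) || (v \in cover Q).
  have : v \in cover (components D) by rewrite cover_components inE.
  case/bigcupP=> C CD vC; case CP: (C \in P).
    by apply/orP; left; apply/bigcupP; exists C.
  by apply/orP; right; apply/bigcupP; exists C => //; rewrite inE CP.
have sepPQ (v w : D) : v \in cover P -> w \in cover Q -> ~~ connect (@adj D) v w.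
  case/bigcupP=> C CP vC /bigcupP[C' /setDP[CD' CP'] wC'].
  have CD := subsetP PC _ CP.
  rewrite (mem_component _ CD vC); apply: contraNN CP' => wC.
  case/and3P: (components_partition D) => _ tI _.
  by rewrite -(def_pblock tI CD' wC') (def_pblock tI CD wC).
have disjPQ (v : D) : v \in cover P -> v \notin cover Q.
  by move=> vP; apply/negP => vQ; have := sepPQ _ _ vP vQ; rewrite connect0.
exists (val @: cover P), (val @: cover Q); split.
- apply/sepP; split.
    apply/pred0P => v /=; apply/negP => /andP[/imsetP[p pP ->]].
    rewrite mem_imset; last exact: val_inj.
    by apply/negP/disjPQ.
  move=> _ _ /imsetP[p pP ->] /imsetP[q qQ ->].
  by apply: contra (sepPQ _ _ pP qQ) => pq; apply: connect1.
- by rewrite card_imset //; apply: val_inj.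
- by rewrite card_imset //; apply: val_inj.
- apply/setP => v; rewrite in_cut; case vT: (v \in T).
    apply/andP; split; apply/negP => /imsetP[w _ vw]; have := valP w;
      by rewrite -vw inE vT.
  have vD : v \in ~: T by rewrite inE vT.
  rewrite -[v]/(val (Sub v vD : D)) !mem_imset; try exact: val_inj.
  by rewrite -negb_or memPQ.
Qed.
End Cuts.

Section Quasi5.
Variable G : sgraph.
Implicit Types (A B T : {set G}).

Lemma sep_small_side A B v : sep A B -> A = [set v] -> deg v <= #|cut A B|.
Proof.
move=> /sepP[_ nAB] Av; apply/subset_leq_card/subsetP => w; rewrite inE => vw.
rewrite in_cut Av inE; apply/andP; split.
  by apply: contraTneq vw => ->; rewrite adj_irr.
by apply: contraTN vw; apply: nAB; rewrite Av inE.
Qed.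

(** A side with a single vertex has its whole neighbourhood in the cut, so the degree bound covers
    exactly the separations that the third premise leaves out. *)
Lemma quasi_connected5_intro :
  4 < #|G| -> (forall v : G, 4 <= deg v) ->
  (forall A B, sep A B -> 1 < #|A| -> 1 < #|B| -> 4 < #|cut A B|) ->
  quasi_connected G 5.
Proof.
move=> cG dG sG; apply/andP; split; last first.
  apply/forallP => T; apply/implyP => /eqP cT; apply/negP.
  by case/nontrivial_cut_sep=> A [B [sAB cA cB defT]]; have := sG _ _ sAB cA cB; rewrite defT cT.
rewrite /k_connected cG; apply/forallP => T; apply/implyP.
case/is_cut_sep=> A [B [sAB cA cB <-]].
case: (ltngtP #|A| 1) cA => // [cA _|/eqP/cards1P[v Av] _]; last first.
  by apply: leq_trans (dG v) _; apply: sep_small_side Av.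
case: (ltngtP #|B| 1) cB => // [cB _|/eqP/cards1P[v Bv] _]; last first.
  rewrite cut_sym; apply: leq_trans (dG v) _; apply: sep_small_side Bv.
  by rewrite sep_sym.
exact: ltnW (sG _ _ sAB cA cB).
Qed.

Lemma quasi_connected5_cut A B : quasi_connected G 5 ->
  sep A B -> 0 < #|A| -> 0 < #|B| -> 4 <= #|cut A B|.
Proof.
case/andP=> /andP[_ /forallP/(_ (cut A B))/implyP cG] _ sAB cA cB.
by apply: cG; apply: sep_is_cut.
Qed.

Lemma quasi_connected5_nontrivial A B : quasi_connected G 5 ->
  sep A B -> 1 < #|A| -> 1 < #|B| -> 4 < #|cut A B|.
Proof.
move=> qG sAB cA cB; rewrite ltn_neqAle quasi_connected5_cut ?(ltnW cA) ?(ltnW cB) //.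
rewrite andbT; case/andP: qG => _ /forallP/(_ (cut A B))/implyP nG.
by rewrite eq_sym; apply/negP => /nG/negP[]; apply: sep_nontrivial_cut.
Qed.
End Quasi5.

Lemma card_imset_kernel (T : finType) (U V : finType) (f : T -> U) (g : T -> V)
    (X : {set T}) :
  (forall v w, g v = g w -> f v = f w) -> #|f @: X| <= #|g @: X|.
Proof.
(* [f] factors through [g] on [X]; the factor takes values in an option type because a point need
   not have a preimage. *)
move=> fg; pose h z := omap f [pick v in X | g v == z].
rewrite -(card_imset (f @: X) Some_inj); apply: leq_trans (leq_imset_card h _).
apply/subset_leq_card/subsetP => _ /imsetP[_ /imsetP[v vX ->] ->].
apply/imsetP; exists (g v); first exact: imset_f.
rewrite /h; case: pickP => [w /andP[_ /eqP/fg fw]|/(_ v)]; first by rewrite /= fw.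
by rewrite vX eqxx.
Qed.

(** * Contractions *)

Section Contract.
Variables (G : sgraph) (H : subgraph G) (phi : G -> G).
Hypothesis phi_edge : forall v w, sub_adj H v w -> phi v = phi w.
Hypothesis phi_connect : forall v, connect (sub_adj H) (phi v) v.

Lemma sub_adj_sym : symmetric (sub_adj H).
Proof. by move=> v w; rewrite /sub_adj /= setUC. Qed.

(** The two hypotheses make [phi] choose one vertex in each component of [H]. The contraction can
    then be studied on [G]: its vertices are the fibres of [phi], and a set of them is counted by
    the [phi]-image of its preimage. *)
Lemma connect_phi v w : connect (sub_adj H) v w = (phi v == phi w).
Proof.
apply/idP/eqP => [/connectP[p pth ->]|vw].
  by elim: p v pth => //= u p IHp v /andP[/phi_edge-> /IHp].
apply: (@connect_trans _ _ (phi v)); last by rewrite vw phi_connect.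
by rewrite (sym_connect_sym sub_adj_sym) phi_connect.
Qed.

Definition class_of (v : G) : {set G} :=
  [set w in [set: G] | connect (sub_adj H) v w].

Lemma class_ofP v : class_of v \in contract_classes H.
Proof. exact: imset_f. Qed.

Definition class_map (v : G) : contract H := Sub (class_of v) (class_ofP v).

Lemma mem_class_map v w : (w \in val (class_map v)) = (phi v == phi w).
Proof. by rewrite /= !inE connect_phi. Qed.

Lemma class_map_phi v w : (class_map v == class_map w) = (phi v == phi w).
Proof.
apply/eqP/eqP => [vw|vw].
  by apply/eqP; rewrite -mem_class_map vw mem_class_map.
by apply: val_inj; apply/setP => u; rewrite !mem_class_map vw.
Qed.

Lemma class_map_surj m : exists v, m = class_map v.
Proof.
case: m => C CH; case/imsetP: (CH) => v _ Cv; exists v.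
exact: val_inj.
Qed.

Lemma card_class_preim (X : {set contract H}) :
  #|phi @: (class_map @^-1: X)| = #|X|.
Proof.
have -> : #|X| = #|class_map @: (class_map @^-1: X)|.
  apply: eq_card => m; apply/idP/imsetP => [mX|[v + ->]]; last by rewrite inE.
  by have [v vm] := class_map_surj m; exists v; rewrite ?inE -?vm.
apply/eqP; rewrite eqn_leq.
by apply/andP; split; apply: card_imset_kernel => v w vw; apply/eqP;
  [rewrite -class_map_phi vw | rewrite class_map_phi vw].
Qed.

Lemma adj_class_map v w v' w' : phi v' = phi v -> phi w' = phi w -> phi v != phi w ->
  adj v' w' -> adj (class_map v) (class_map w).
Proof.
move=> vv ww vw a; apply/andP; split; first by rewrite class_map_phi.
apply/exists_inP; exists v'; first by rewrite mem_class_map vv.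
by apply/exists_inP; exists w'; rewrite // mem_class_map ww.
Qed.

(** The sides of a cut of the contraction pull back to sets that are unions of classes, which is the
    saturation assumed of [A] and [B]; cardinalities in the contraction become cardinalities of
    [phi]-images. *)
Lemma quasi_contractible_intro :
  4 < #|phi @: [set: G]| ->
  (forall v, 4 <= #|phi @: [set w | (phi w != phi v) &&
                              [exists v', (phi v' == phi v) && adj v' w]]|) ->
  (forall A B : {set G}, sep A B ->
     (forall v w, phi v = phi w -> v \in A -> w \in A) ->
     (forall v w, phi v = phi w -> v \in B -> w \in B) ->
     1 < #|phi @: A| -> 1 < #|phi @: B| -> 4 < #|phi @: cut A B|) ->
  quasi_contractible H 5.
Proof.
move=> cG dG sG; apply: quasi_connected5_intro.
- by rewrite -cardsT -card_class_preim preimsetT.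
- move=> m; have [v ->] := class_map_surj m; apply: leq_trans (dG v) _.
  rewrite /deg -card_class_preim; apply/subset_leq_card/imsetS/subsetP => w.
  rewrite !inE => /andP[wv /existsP[v' /andP[/eqP vv a]]].
  by apply: (adj_class_map vv (erefl _)) a; rewrite eq_sym.
- move=> A B /sepP[dAB nAB] cA cB.
  have := sG (class_map @^-1: A) (class_map @^-1: B).
  rewrite !card_class_preim.
  have -> : cut (class_map @^-1: A) (class_map @^-1: B) = class_map @^-1: cut A B.
    by apply/setP => v; rewrite in_cut [RHS]inE in_cut !inE.
  rewrite card_class_preim; apply=> //.
  + apply/sepP; split=> [|v w].
      apply/pred0P => v /=; rewrite !inE; have := pred0P dAB (class_map v).
      by [].
    rewrite !inE => vA wB; apply: contra (nAB _ _ vA wB).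
    apply: adj_class_map => //; rewrite -class_map_phi; apply: contraTneq vA => ->.
    by apply/negP => wA; have := pred0P dAB (class_map w); rewrite /= wA wB.
  + by move=> v w /eqP; rewrite -class_map_phi !inE => /eqP->.
  + by move=> v w /eqP; rewrite -class_map_phi !inE => /eqP->.
Qed.
End Contract.

(** * Searching the placements of named vertices *)

Section Squeeze.
Variable G : sgraph.
Hypothesis qG : quasi_connected G 5.
Implicit Types (X L : {set G}).

(** [L] may be larger than the true boundary of [X]. It separates [X] from the rest, so quasi
    5-connectedness applies with the rest as a side of at least two vertices. *)
Lemma squeeze X L :
  (forall v w, v \in X -> adj v w -> w \in X :|: L) ->
  [disjoint X & L] -> 1 < #|~: (X :|: L)| ->
  (#|L| <= 4 -> #|X| <= 1) /\ (#|L| <= 3 -> #|X| = 0).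
Proof.
move=> XL dXL cR; set R := ~: (X :|: L) in cR.
have sXR : sep X R.
  apply/sepP; split.
    by apply/pred0P => v; rewrite /= !inE; case: (v \in X).
  by move=> v w vX; rewrite inE => wR; apply: contra wR; apply: XL.
have cutL : cut X R = L.
  apply/setP => v; rewrite in_cut !inE negbK.
  by case vX: (v \in X) => //=; have := pred0P dXL v; rewrite /= vX /= => ->.
split=> cL; first rewrite leqNgt; last apply/eqP; last rewrite -leqn0 leqNgt.
  by apply/negP => /(quasi_connected5_nontrivial qG sXR)/(_ cR); rewrite cutL; lia.
by apply/negP => /(quasi_connected5_cut qG sXR)/(_ (ltnW cR)); rewrite cutL; lia.
Qed.

Hypothesis card_G : 14 <= #|G|.

(** At most 8 + 4 vertices are listed, so two of the 14 remain and [squeeze] would leave at most one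
    vertex in [s]. *)
Lemma small_boundary (s t : seq G) :
  uniq s -> ~~ has (mem t) s -> 1 < size s -> size t <= 4 -> size s <= 8 ->
  (forall v w, v \in s -> adj v w -> w \in s ++ t) -> False.
Proof.
move=> us dst s1 t4 s8 st; pose X := [set v in s]; pose L := [set v in t].
have cX : #|X| = size s by rewrite cardsE; apply/card_uniqP.
have cL : #|L| <= size t by rewrite cardsE card_size.
have [] := @squeeze X L.
- by move=> v w; rewrite !inE -mem_cat; apply: st.
- apply/pred0P => v /=; rewrite !inE; apply/negP => /andP[vs vt].
  by move/hasPn/(_ v vs)/negP: dst; apply.
- by have := cardsC (X :|: L); have := cardsUI X L; lia.
- by lia.
Qed.

Lemma deg_ge4 (v : G) : 4 <= deg v.
Proof.
rewrite leqNgt; apply/negP => dv.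
have [] := @squeeze [set v] (nbhd v).
- by move=> u w /set1P->; rewrite !inE => ->; rewrite orbT.
- by apply/pred0P => w; rewrite /= !inE; apply/negP => /andP[/eqP->]; rewrite adj_irr.
- have := cardsC ([set v] :|: nbhd v); have := cardsUI [set v] (nbhd v).
  by rewrite cards1 /deg in dv *; lia.
- by rewrite cards1 => _ /(_ dv).
Qed.
End Squeeze.

(** [Some true] and [Some false] stand for the two sides of a cut, [None] for the
    cut itself. *)
Definition place := option bool.

(** A partially known graph on vertices numbered from 0: some of its edges, and for
    some vertices a list containing all their neighbours. *)
Record frame := Frame {
  names : nat;
  known_edges : seq (nat * nat);
  closed_nbhds : seq (nat * seq nat) }.

Definition mask_diff (u v : seq bool) := [seq p.1 && ~~ p.2 | p <- zip u v].
Definition mask_union (u v : seq bool) := [seq p.1 || p.2 | p <- zip u v].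
Definition mask_disjoint (u v : seq bool) := ~~ has (fun p => p.1 && p.2) (zip u v).

Fixpoint submasks (m : seq bool) : seq (seq bool) :=
  if m is b :: m' then
    let r := submasks m' in
    map (cons false) r ++ (if b then map (cons true) r else [::])
  else [:: [::]].

Section Search.
Variables (F : frame) (allowed : nat -> seq place) (k : nat).

(** The default [None] accepts an edge with an end that is not placed yet, so the test also makes
    sense for prefixes. *)
Definition compatible (s : seq place) : bool :=
  all (fun e => match nth None s e.1, nth None s e.2 with
                | Some b, Some c => b == c | _, _ => true end) (known_edges F).

(** Both tests pass from a placement to its prefixes, so filtering at every length loses nothing and
    keeps the enumeration small. *)
Fixpoint placements (m : nat) : seq (seq place) :=
  if m is m'.+1 then
    [seq s <- [seq rcons s p | s <- placements m', p <- allowed m'] |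
      (count_mem None s <= k) && compatible s]
  else [:: [::]].

Definition mask_of (s : seq place) (p : place) : seq bool := [seq q == p | q <- s].

Definition closed_masks : seq (nat * seq bool) :=
  [seq (c.1, mkseq (fun j => j \in c.2) (names F)) | c <- closed_nbhds F].

(** When the vertices of [D] leave a side, the boundary of what remains consists of
    the cut and [D], without the vertices known to have no neighbour left there.
    At most 3 boundary vertices leave nothing, 4 leave at most one vertex; 14 is
    the absence of a bound. *)
Definition removal_bound (closed : seq (nat * seq bool)) (side mid D : seq bool) : nat :=
  let rest := mask_diff side D in
  let out := mask_union mid D in
  let boundary := k + count id D -
    count (fun c => nth false out c.1 && mask_disjoint c.2 rest) closed in
  if boundary <= 3 then count id D else if boundary <= 4 then (count id D).+1 else 14.

Definition side_bound (closed : seq (nat * seq bool)) (s : seq place) (b : bool) : nat :=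
  let side := mask_of s (Some b) in
  let mid := mask_of s None in
  foldr minn 14 [seq removal_bound closed side mid D | D <- submasks side].

(** A side has at least two vertices and at least its named ones, and both sides with the cut have
    at least 14. The conditional, unlike a conjunction, spares [vm_compute] the second bound when
    the first already fails. *)
Definition survives (closed : seq (nat * seq bool)) (s : seq place) : bool :=
  let bT := side_bound closed s true in
  if maxn 2 (count_mem (Some true) s) <= bT then
    let bF := side_bound closed s false in
    (maxn 2 (count_mem (Some false) s) <= bF) && (14 <= bT + bF + k)
  else false.

Definition survivors : seq (seq place) :=
  let closed := closed_masks in [seq s <- placements (names F) | survives closed s].
End Search.

Section Soundness.
Variables (G : sgraph) (F : frame) (f : nat -> G).
Hypothesis qG : quasi_connected G 5.
Hypothesis card_G : 14 <= #|G|.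
Hypothesis f_inj : forall i j, i < names F -> j < names F -> f i = f j -> i = j.
Hypothesis f_edge : forall e, e \in known_edges F -> adj (f e.1) (f e.2).
Hypothesis f_closed : forall c, c \in closed_nbhds F -> forall v, adj (f c.1) v ->
  exists2 j, (j \in c.2) && (j < names F) & v = f j.

Hypothesis closed_uniq : uniq (map fst (closed_nbhds F)).

Variables (A B : {set G}) (allowed : nat -> seq place) (k : nat).
Hypothesis sAB : sep A B.
Hypothesis cut_k : #|cut A B| <= k.
Hypothesis A_gt1 : 1 < #|A|.
Hypothesis B_gt1 : 1 < #|B|.

Definition place_of (v : G) : place :=
  if v \in A then Some true else if v \in B then Some false else None.

Definition side_set (b : bool) : {set G} := if b then A else B.

Hypothesis f_allowed : forall i, i < names F -> place_of (f i) \in allowed i.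

Definition placement m := mkseq (place_of \o f) m.

Lemma in_side b v : (v \in side_set b) = (place_of v == Some b).
Proof.
have := sAB => /sepP[/pred0P/(_ v)/= dAB _].
by rewrite /place_of; case: b => /=; move: dAB; case: (v \in A); case: (v \in B).
Qed.

Lemma in_middle v : (v \in cut A B) = (place_of v == None).
Proof. by rewrite in_cut /place_of; case: (v \in A); case: (v \in B). Qed.

Lemma side_disjoint b v : v \in side_set b -> v \in side_set (~~ b) -> False.
Proof. by rewrite !in_side => /eqP-> /eqP[]; case: b. Qed.

Lemma side_nonadj b v w : v \in side_set b -> w \in side_set (~~ b) -> ~~ adj v w.
Proof.
case/sepP: sAB => _ nAB; case: b => /= vb wb; first exact: nAB.
by rewrite adj_sym nAB.
Qed.

Lemma nth_placement m i : i < m -> nth None (placement m) i = place_of (f i).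
Proof. exact: nth_mkseq. Qed.

Definition indices (m : seq bool) : seq nat := [seq i <- iota 0 (names F) | nth false m i].

Lemma mem_indices m i : (i \in indices m) = (i < names F) && nth false m i.
Proof. by rewrite mem_filter mem_iota /= add0n andbC. Qed.

Lemma indices_uniq m : uniq (indices m).
Proof. by rewrite filter_uniq ?iota_uniq. Qed.

Lemma size_indices m : size m = names F -> size (indices m) = count id m.
Proof.
by move=> sz; rewrite size_filter -[in RHS](mkseq_nth false m) sz count_map.
Qed.

Lemma size_indices_image (m : seq bool) : size m = names F ->
  #|[set v in [seq f i | i <- indices m]]| = count id m.
Proof.
move=> sz; rewrite cardsE (card_uniqP _) ?size_map ?size_indices //.
rewrite map_inj_in_uniq ?indices_uniq // => i j.
by rewrite !mem_indices => /andP[iF _] /andP[jF _]; apply: f_inj.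
Qed.

Lemma nth_mask_of p i : i < names F ->
  nth false (mask_of (placement (names F)) p) i = (place_of (f i) == p).
Proof. by move=> iF; rewrite (nth_map None) ?size_mkseq // nth_placement. Qed.

Lemma placements_sound m : m <= names F -> placement m \in placements F allowed k m.
Proof.
elim: m => [|m IHm] mF /=; first by rewrite inE.
rewrite mem_filter; apply/andP; split; last first.
  rewrite /placement mkseqS; apply: allpairs_f; first exact/IHm/ltnW.
  exact: f_allowed.
apply/andP; split.
  apply: leq_trans cut_k.
  have fi : {in gtn m.+1 &, injective f}.
    by move=> i j /= im jm; apply: f_inj; apply: leq_trans mF; rewrite // -ltnS.
  rewrite -size_filter; set s := filter _ _.
  have -> : size s = size [seq f i | i <- iota 0 m.+1 & place_of (f i) == None].
    by rewrite size_map /s size_filter /placement /mkseq count_map size_filter.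
  rewrite -(card_uniqP _); last first.
    rewrite map_inj_in_uniq ?filter_uniq ?iota_uniq // => i j.
    by rewrite !mem_filter !mem_iota /= !add0n => /andP[_ im] /andP[_ jm]; apply: fi.
  apply/subset_leq_card/subsetP => v /mapP[i]; rewrite mem_filter -in_middle.
  by case/andP=> iK _ ->.
apply/allP => e eF.
case: (ltnP e.1 m.+1) => e1; last by rewrite nth_default ?size_mkseq.
case: (ltnP e.2 m.+1) => e2; last by rewrite [nth None _ e.2]nth_default ?size_mkseq //; case: nth.
rewrite !nth_placement //.
case p1: (place_of _) => [b|//]; case p2: (place_of _) => [c|//].
move/eqP: p1; rewrite -in_side => p1; move/eqP: p2; rewrite -in_side => p2.
have := f_edge eF; case/sepP: sAB => _ nAB.
case: b p1 => p1; case: c p2 => p2 //; first by rewrite (negbTE (nAB _ _ p1 p2)).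
by rewrite adj_sym (negbTE (nAB _ _ p2 p1)).
Qed.

Lemma submasksP (m D : seq bool) : D \in submasks m ->
  size D = size m /\ forall i, nth false D i -> nth false m i.
Proof.
elim: m D => [|b m IHm] D; first by rewrite inE => /eqP->.
rewrite [submasks _]/= mem_cat => /orP[/mapP[D' /IHm[sz sD] ->]|].
  by rewrite /= sz; split=> // -[|i] //= /sD.
by case: b => // /mapP[D' /IHm[sz sD] ->]; rewrite /= sz; split=> // -[|i] //= /sD.
Qed.

Lemma nth_mask_diff u v i : size u = size v ->
  nth false (mask_diff u v) i = nth false u i && ~~ nth false v i.
Proof.
move=> uv; case: (ltnP i (size v)) => iv.
  by rewrite (nth_map (false, false)) ?size_zip ?uv ?minnn // nth_zip.
by rewrite !nth_default // ?size_map ?size_zip uv ?minnn.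
Qed.

Lemma nth_mask_union u v i : size u = size v ->
  nth false (mask_union u v) i = nth false u i || nth false v i.
Proof.
move=> uv; case: (ltnP i (size v)) => iv.
  by rewrite (nth_map (false, false)) ?size_zip ?uv ?minnn // nth_zip.
by rewrite !nth_default // ?size_map ?size_zip uv ?minnn.
Qed.

Lemma mask_disjointP u v i : size u = size v -> mask_disjoint u v ->
  nth false u i -> nth false v i -> False.
Proof.
move=> uv /hasPn uvd ui vi; case: (ltnP i (size v)) => iv; last by rewrite nth_default in vi.
have := uvd (nth (false, false) (zip u v) i).
by rewrite mem_nth ?size_zip ?uv ?minnn // nth_zip //= ui vi => /(_ isT).
Qed.

(** [squeeze] is applied to the side without [D], with boundary the cut and [D] less the dead
    vertices. A dead vertex has a closed list that misses the named part of what remains; since all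
    its neighbours are named, it has no neighbour in the whole remainder. *)
Lemma removal_boundP b D :
  let s := placement (names F) in
  D \in submasks (mask_of s (Some b)) ->
  minn #|side_set b| 14 <=
    removal_bound k (closed_masks F) (mask_of s (Some b)) (mask_of s None) D.
Proof.
move=> s /submasksP[]; rewrite size_map size_mkseq => szD sD; rewrite /removal_bound.
set rest := mask_diff _ _; set out := mask_union _ _; set dl := count _ (closed_masks F).
have szs p : size (mask_of s p) = names F by rewrite size_map size_mkseq.
have restE i : nth false rest i = nth false (mask_of s (Some b)) i && ~~ nth false D i.
  by rewrite nth_mask_diff ?szs.
have outE i : nth false out i = nth false (mask_of s None) i || nth false D i.
  by rewrite nth_mask_union ?szs.
pose fD := [set v in [seq f i | i <- indices D]].
pose is_dead (c : nat * seq nat) := nth false out c.1 &&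
  mask_disjoint (mkseq (fun j => j \in c.2) (names F)) rest.
pose dead := [seq c.1 | c <- closed_nbhds F & is_dead c].
pose dead_set := [set v in map f dead].
pose X := side_set b :\: fD; pose L := (cut A B :|: fD) :\: dead_set.
have cfD : #|fD| = count id D by rewrite size_indices_image.
have fDb v : v \in fD -> v \in side_set b.
  rewrite inE => /mapP[i]; rewrite mem_indices => /andP[iF /sD].
  by rewrite nth_mask_of // -in_side => + ->.
have outP i : i < names F -> nth false out i -> f i \in cut A B :|: fD.
  move=> iF; rewrite outE in_setU nth_mask_of // in_middle => /orP[->//|iD].
  by rewrite inE map_f ?orbT // mem_indices iF.
have deadP i : i \in dead -> i < names F /\ f i \in cut A B :|: fD.
  case/mapP=> c; rewrite mem_filter => /andP[/andP[co _] _] ->.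
  suff cF : c.1 < names F by split=> //; apply: outP.
  rewrite ltnNge; apply: contraL co => cF; rewrite nth_default //.
  by rewrite size_map size_zip szs szD minnn.
(* By [closed_uniq] different entries concern different names, hence different vertices, so counting
   entries counts the vertices dropped from the boundary. *)
have cdead : #|dead_set| = dl.
  rewrite cardsE (card_uniqP _).
    by rewrite !size_map size_filter /dl /closed_masks count_map.
  rewrite map_inj_in_uniq; last first.
    by move=> i j /deadP[iF _] /deadP[jF _]; apply: f_inj.
  by apply: subseq_uniq closed_uniq; apply: map_subseq; apply: filter_subseq.
have cL : #|L| <= k + count id D - dl.
  rewrite /L cardsD (setIidPr _) ?cdead; last first.
    by apply/subsetP => v; rewrite inE => /mapP[i /deadP[_ +] ->].
  apply: leq_sub2r; rewrite -cfD; apply: leq_trans (leq_card_setU _ _) _.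
  by rewrite leq_add2r.
have cS : #|side_set b| <= #|X| + count id D.
  rewrite -cfD; apply: leq_trans (leq_card_setU _ _).
  by apply/subset_leq_card/subsetP => v; rewrite !in_setU in_setD => ->; case: (v \in fD).
have [] := @squeeze G qG X L.
- move=> v w /setDP[vb vD] vw.
  have wbK : w \in side_set b :|: cut A B.
    rewrite in_setU in_middle in_side; case wp: (place_of w) => [c|]; last by rewrite orbT.
    rewrite orbF; case: (b =P c) => [->//|bc].
    have {}wp : w \in side_set (~~ b).
      by rewrite in_side wp; apply/eqP; congr Some; move: bc; case: (b); case: (c).
    by case/negP: (side_nonadj vb wp).
  have ndead : w \notin dead_set.
    rewrite inE; apply/negP => /mapP[i /mapP[c]].
    rewrite mem_filter => /andP[/andP[_ cd] cF] -> wi.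
    have [|j /andP[jc jF] vj] := f_closed cF (v := v).
      by rewrite -wi adj_sym.
    apply: (mask_disjointP (i := j) _ cd); first by rewrite size_mkseq size_map size_zip szs szD minnn.
      by rewrite nth_mkseq.
    rewrite restE nth_mask_of // -in_side -vj vb /=.
    by apply: contra vD => jD; rewrite inE vj map_f // mem_indices jF.
  rewrite in_setU in_setD in_setD in_setU ndead /=.
  by move: wbK; rewrite in_setU; case: (w \in fD); case: (w \in side_set b); case: (w \in cut A B).
- apply/pred0P => v; rewrite /= in_setD in_setD in_setU.
  case: (boolP (v \in fD)) => //= vD; apply/negP => /andP[vb /andP[_]].
  by rewrite orbF in_middle; move: vb; rewrite in_side => /eqP->.
(* The opposite side is disjoint from both sets and supplies the two outside vertices. *)
- apply: (@leq_trans #|side_set (~~ b)|); first by case: (b).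
  apply/subset_leq_card/subsetP => v vb; rewrite in_setC in_setU negb_or !in_setD in_setU.
  have nb : v \notin side_set b by apply/negP => /side_disjoint; apply.
  rewrite (negbTE nb) andbF /= (contraNF (fDb v)) // orbF negb_and.
  by apply/orP; right; rewrite in_middle; move: vb; rewrite in_side => /eqP->.
- move=> h4 h3; case: ifP => [b3|_]; last case: ifP => [b4|_]; last exact: geq_minr.
    by rewrite geq_min (leq_trans cS) // (h3 (leq_trans cL b3)).
  by rewrite geq_min (leq_trans cS) // -add1n leq_add2r (h4 (leq_trans cL b4)).
Qed.

Lemma side_boundP b :
  minn #|side_set b| 14 <= side_bound k (closed_masks F) (placement (names F)) b.
Proof.
rewrite /side_bound; set m := mask_of _ _.
have : {subset submasks m <= submasks m} by [].
elim: {1 3}(submasks m) => [|D l IHl] sl /=; first exact: geq_minr.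
rewrite leq_min removal_boundP ?sl ?mem_head // IHl // => D' D'l.
by apply: sl; rewrite inE D'l orbT.
Qed.

Lemma count_place b : count_mem (Some b) (placement (names F)) <= #|side_set b|.
Proof.
set s := placement _; have sz : size (mask_of s (Some b)) = names F.
  by rewrite size_map size_mkseq.
have -> : count_mem (Some b) s = count id (mask_of s (Some b)).
  by rewrite /mask_of count_map; apply: eq_count.
rewrite -(size_indices_image sz); apply/subset_leq_card/subsetP => v.
rewrite inE => /mapP[i]; rewrite mem_indices => /andP[iF].
by rewrite nth_mask_of // -in_side => + ->.
Qed.

(** The side bounds are capped at 14, so the number of names must not exceed 14 for the named
    vertices on a side to be compared with them. *)
Lemma survivors_sound : names F <= 14 -> placement (names F) \in survivors F allowed k.
Proof.
move=> F14; rewrite mem_filter placements_sound // andbT /survives.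
have cs b : count_mem (Some b) (placement (names F)) <= 14.
  by apply: leq_trans (count_size _ _) _; rewrite size_mkseq.
have c0 := card_sep sAB; have := side_boundP true; have := side_boundP false.
have := count_place true; have := count_place false; have := cs true; have := cs false.
rewrite /side_set; move: (side_bound _ _ _ true) (side_bound _ _ _ false) => bT bF.
move: (count_mem _ _) (count_mem _ _) => cT cF *.
by case: ifP => [_|/negP[]]; [apply/andP; split; lia | lia].
Qed.
End Soundness.

(** * Contracting stars *)

Section Star.
Variable G : sgraph.
Implicit Types (es : seq (G * G)) (A B : {set G}).

Definition edge_sets es : {set {set G}} := [set e in [seq [set p.1; p.2] | p <- es]].

Lemma edge_sets_edges es : all (fun p => adj p.1 p.2) es -> edge_sets es \subset edges G.
Proof.
move=> /allP aes; apply/subsetP => e; rewrite !inE => /mapP[p /aes pa ->].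
by apply/existsP; exists p.1; apply/existsP; exists p.2; rewrite pa eqxx.
Qed.

Lemma edge_sets_ends es e : e \in edge_sets es -> e \subset [set: G].
Proof. by rewrite subsetT. Qed.

Definition subgraph_of es (aes : all (fun p => adj p.1 p.2) es) : subgraph G :=
  Subgraph (edge_sets_edges aes) (@edge_sets_ends es).

(** For disjoint stars given by their edges (centre, leaf), the map contracting each
    leaf to its centre. *)
Definition leaf_center es (v : G) : G :=
  foldr (fun p r => if v == p.2 then p.1 else r) v es.

(** The [phi]-image of this set has as many elements as the degree of the class of [v] in the
    contraction. *)
Definition class_nbhd (phi : G -> G) (v : G) : {set G} :=
  [set w | (phi w != phi v) && [exists v', (phi v' == phi v) && adj v' w]].

Lemma leaf_centerN es v : v \notin map snd es -> leaf_center es v = v.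
Proof.
elim: es => //= p es IHes; rewrite inE negb_or => /andP[/negbTE->].
exact: IHes.
Qed.

Lemma leaf_centerE es p : uniq (map snd es) -> p \in es -> leaf_center es p.2 = p.1.
Proof.
elim: es => //= q es IHes /andP[qes ues]; rewrite inE => /orP[/eqP->|pes].
  by rewrite eqxx.
case: eqP => [pq|_]; last exact: IHes.
by case/negP: qes; rewrite -pq map_f.
Qed.

Lemma leaf_centerP es v : v \in map snd es -> uniq (map snd es) ->
  (leaf_center es v, v) \in es.
Proof. by case/mapP=> -[p q] pes -> /= ues; rewrite (leaf_centerE ues pes). Qed.

(** Vertices that are not leaves are fixed by [phi], so passing from a set to its image loses at
    most the leaves in it. A bad cut of the contraction therefore has at most 4 vertices more than
    it has leaves. *)
Lemma star_contraction es (aes : all (fun p => adj p.1 p.2) es) :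
  14 <= #|G| -> size es <= 3 -> uniq (map snd es) ->
  ~~ has (mem (map fst es)) (map snd es) ->
  (forall v, 4 <= #|leaf_center es @: class_nbhd (leaf_center es) v|) ->
  (forall A B, sep A B ->
     (forall p, p \in es -> (p.1 \in A) = (p.2 \in A)) ->
     (forall p, p \in es -> (p.1 \in B) = (p.2 \in B)) ->
     1 < #|leaf_center es @: A| -> 1 < #|leaf_center es @: B| ->
     #|cut A B| <= 4 + #|cut A B :&: [set v in map snd es]| -> False) ->
  quasi_contractible (subgraph_of aes) 5.
Proof.
move=> cG s3 ues dis dlow dsep.
set phi := leaf_center es in dlow dsep *; set D := [set v in map snd es] in dsep.
have phi_fst p : p \in es -> phi p.1 = p.1.
  move=> pes; apply: leaf_centerN; apply/negP => p2.
  by move/hasPn/(_ _ p2)/negP: dis; apply; rewrite /= map_f.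
have cD (X : {set G}) : #|X| <= #|phi @: X| + #|X :&: D|.
  rewrite -(cardsID D X) addnC leq_add2r; apply/subset_leq_card/subsetP => v.
  by rewrite !inE => /andP[vD vX]; apply/imsetP; exists v; rewrite ?/phi ?leaf_centerN.
have cD3 : #|D| <= 3.
  by apply: leq_trans s3; rewrite cardsE -(size_map snd) card_size.
apply: (@quasi_contractible_intro _ _ phi).
- move=> v w; rewrite /sub_adj /= inE => /mapP[p pes vw].
  have [v1 w1] : v \in [set p.1; p.2] /\ w \in [set p.1; p.2].
    by rewrite -vw !inE !eqxx orbT.
  have phi2 : phi p.2 = phi p.1 by rewrite (phi_fst _ pes) [LHS](leaf_centerE ues pes).
  by move: v1 w1; rewrite !inE => /orP[]/eqP-> /orP[]/eqP->.
- move=> v; case: (boolP (v \in map snd es)) => [vD|vD]; last first.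
    by rewrite /phi leaf_centerN ?connect0.
  apply: connect1; rewrite /sub_adj /= inE; apply/mapP.
  by exists (phi v, v) => //; apply: leaf_centerP.
- have := cD setT; rewrite cardsT setTI; lia.
- exact: dlow.
- move=> A B sAB satA satB cA cB; rewrite ltnNge; apply/negP => c4.
  have phi12 p : p \in es -> phi p.1 = phi p.2.
    by move=> pes; rewrite (phi_fst _ pes) [RHS](leaf_centerE ues pes).
  apply: (dsep A B) => //.
  + by move=> p /phi12 p12; apply/idP/idP; apply: satA.
  + by move=> p /phi12 p12; apply/idP/idP; apply: satB.
  + by apply: leq_trans (cD _) _; rewrite leq_add2r.
Qed.
End Star.

(** * What the failure of a contraction provides *)

Section Obstructions.
Variable G : sgraph.
Hypothesis qG : quasi_connected G 5.
Hypothesis card_G : 14 <= #|G|.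
Hypothesis no_contractible : forall H : subgraph G,
  1 <= #|sub_edges H| <= 3 -> ~~ quasi_contractible H 5.
Implicit Types (A B : {set G}).

Lemma star_not_contractible (es : seq (G * G)) (aes : all (fun p => adj p.1 p.2) es) :
  0 < size es <= 3 -> ~ quasi_contractible (subgraph_of aes) 5.
Proof.
case/andP=> s0 s3; apply/negP/no_contractible/andP; split.
  case: es aes s0 {s3} => // p es aes _; apply/card_gt0P.
  by exists [set p.1; p.2]; rewrite inE mem_head.
by apply: leq_trans s3; rewrite /= cardsE -(size_map (fun p => [set p.1; p.2])) card_size.
Qed.

Lemma star_class_nbhd (es : seq (G * G)) (v : G) :
  leaf_center es v = v -> v \notin map fst es -> uniq (map snd es) ->
  v \notin map snd es ->
  class_nbhd (leaf_center es) v = nbhd v.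
Proof.
move=> vv v1 ues v2; have fib w : (leaf_center es w == v) = (w == v).
  apply/eqP/eqP => [wv|->//]; case: (boolP (w \in map snd es)) => [wD|/leaf_centerN <-//].
  have := leaf_centerP wD ues; rewrite wv => /(map_f fst)/= vD.
  by rewrite vD in v1.
apply/setP => w; rewrite !inE vv fib; apply/andP/idP.
  by case=> _ /existsP[v']; rewrite fib => /andP[/eqP->].
move=> vw; split; first by apply: contraTneq vw => ->; rewrite adj_irr.
by apply/existsP; exists v; rewrite vv eqxx.
Qed.

(** The last two premises exclude both ways in which contracting the star with centre [p] and leaves
    [s] can fail: a vertex outside of too small degree, and a bad cut. Only cuts containing the
    whole star are left to the user. *)
Lemma star_obstruction (p : G) (s : seq G) :
  0 < size s <= 3 -> uniq (p :: s) -> (forall q, q \in s -> adj p q) ->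
  (forall v, v \notin p :: s -> 2 < #|nbhd v :\: [set w in p :: s]|) ->
  (forall A B, sep A B -> 1 < #|A| -> 1 < #|B| ->
     {subset p :: s <= cut A B} -> #|cut A B| <= 4 + size s -> False) -> False.
Proof.
case/andP=> s0 s3 /= /andP[ps us] padj noV noS; pose es := [seq (p, q) | q <- s].
have es2 : map snd es = s by rewrite -map_comp map_id.
have aes : all (fun e => adj e.1 e.2) es.
  by apply/allP => _ /mapP[q /padj pq ->].
have phiE w : leaf_center es w = if w \in s then p else w.
  case: ifP => ws; last by apply: leaf_centerN; rewrite es2 ws.
  by rewrite -[w in LHS]/((p, w).2) leaf_centerE ?es2 //; apply/mapP; exists w.
have phi_blob w : (leaf_center es w == p) = (w \in p :: s).
  by rewrite phiE inE; case: (w \in s); rewrite ?eqxx ?orbT ?orbF.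
case: (@star_not_contractible es aes); first by rewrite size_map s0.
apply: star_contraction; rewrite ?es2 ?size_map //.
- apply/hasPn => q qs; apply/negP => /mapP[[_ r] /mapP[r' _ [-> _]] /= qp].
  by rewrite qp (negbTE ps) in qs.
- move=> v; rewrite leqNgt; apply/negP => lo.
  case: (boolP (v \in p :: s)) => vps.
    have /eqP vp : leaf_center es v == p by rewrite phi_blob.
    (* If the contracted vertex had degree at most 3, the star itself would be enclosed by at most
       three vertices. *)
    apply: (@small_boundary G qG card_G (p :: s) (enum (class_nbhd (leaf_center es) v))).
    + by rewrite /= ps.
    + by apply/hasPn => w wps; rewrite /= mem_enum inE vp phi_blob wps.
    + by [].
    + rewrite -cardE; apply: leq_trans (_ : 3 <= 4) => //; rewrite -ltnS.
      suff inj : {in class_nbhd (leaf_center es) v &, injective (leaf_center es)}.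
        by rewrite (card_in_imset inj) in lo.
      move=> w w'; rewrite !inE vp !phiE.
      by case: (w \in s); case: (w' \in s); rewrite ?eqxx.
    + by rewrite /=; lia.
    + move=> u w ups uw; rewrite mem_cat; case: (boolP (w \in p :: s)) => //= wps.
      rewrite mem_enum in_set vp phi_blob (negbTE wps).
      by apply/existsP; exists u; rewrite uw phi_blob ups.
  have := vps; rewrite inE negb_or => /andP[vp vs].
  have es1 : v \notin map fst es.
    by rewrite -map_comp; apply: contra vp => /mapP[q _ ->].
  rewrite star_class_nbhd ?es2 // ?phiE ?(negbTE vs) // in lo.
  have := deg_ge4 qG card_G v; have := noV v vps.
  set Z := _ :\: _ => Z3 dv.
  have ZN : Z \subset leaf_center es @: nbhd v.
    apply/subsetP => w; rewrite !inE negb_or => /andP[/andP[_ ws] vw].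
    by apply/imsetP; exists w; rewrite ?inE // phiE (negbTE ws).
  (* With a neighbour in the star, the contracted vertex [p] is a fourth neighbour besides those in
     [Z]; without one, [Z] is the whole neighbourhood of [v]. *)
  case: (boolP [exists w in nbhd v, w \in p :: s]) => [/exists_inP[w vw wps]|].
    have : p |: Z \subset leaf_center es @: nbhd v.
      rewrite subUset sub1set ZN andbT; apply/imsetP; exists w => //.
      by apply/esym/eqP; rewrite phi_blob.
    by move/subset_leq_card; rewrite cardsU1 !inE eqxx /=; lia.
  rewrite negb_exists_in => /forall_inP nps.
  suff ZE : Z = nbhd v by have := subset_leq_card ZN; rewrite ZE /deg in dv *; lia.
  apply/setP => w; rewrite in_setD; case: (boolP (w \in nbhd v)) => [/nps|] //=.
    by rewrite inE => ->.
  by rewrite andbF.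
- move=> A B sAB satA satB cA cB cc.
  have {}cA : 1 < #|A| by apply: leq_trans cA (leq_imset_card _ _).
  have {}cB : 1 < #|B| by apply: leq_trans cB (leq_imset_card _ _).
  have sat q : q \in s -> (q \in cut A B) = (p \in cut A B).
    move=> qs; have pq : (p, q) \in es by apply/mapP; exists q.
    by rewrite !in_cut -(satA _ pq) -(satB _ pq).
  (* If the centre avoids the cut, so do its leaves, and the cut already has at most four vertices
     in [G]. *)
  case: (boolP (p \in cut A B)) => pc; last first.
    have := quasi_connected5_nontrivial qG sAB cA cB; rewrite ltnNge => /negP; apply.
    apply: leq_trans cc _; rewrite -[X in _ <= X]addn0 leq_add2l leqn0 cards_eq0.
    apply/eqP/setP => w; rewrite in_setI in_set0 inE.
    by case: (boolP (w \in s)) => [/sat->|_]; rewrite ?andbF ?(negbTE pc).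
  apply: (noS A B) => //.
    by move=> q; rewrite inE => /orP[/eqP->//|/sat->].
  apply: leq_trans cc _; rewrite leq_add2l.
  by apply: leq_trans (subset_leq_card (subsetIr _ _)) _; rewrite cardsE card_size.
Qed.

(** The sides are measured after contraction, because a side consisting of one contracted edge
    counts as a single vertex and must be ruled out by the caller. *)
Lemma two_edge_obstruction (b u y v : G) : uniq [:: b; u; y; v] -> adj b u -> adj y v ->
  (forall w, 4 <= #|leaf_center [:: (b, u); (y, v)] @: class_nbhd (leaf_center [:: (b, u); (y, v)]) w|) ->
  (forall A B, sep A B -> (b \in A) = (u \in A) -> (b \in B) = (u \in B) ->
     (y \in A) = (v \in A) -> (y \in B) = (v \in B) ->
     1 < #|leaf_center [:: (b, u); (y, v)] @: A| -> 1 < #|leaf_center [:: (b, u); (y, v)] @: B| ->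
     #|cut A B| <= 4 + (u \in cut A B) + (v \in cut A B) -> False) -> False.
Proof.
move=> ubuyv bu yv low noS; pose es := [:: (b, u); (y, v)].
have aes : all (fun e => adj e.1 e.2) es by rewrite /= bu yv.
case: (@star_not_contractible es aes isT); apply: star_contraction => //=.
- by move: ubuyv; rewrite /= !inE; do ![case: (_ == _) => //].
- move: ubuyv; rewrite /= !inE ![u == _]eq_sym ![v == _]eq_sym.
  by do ![case: (_ == _) => //].
- move=> A B sAB satA satB cA cB cc; apply: (noS A B) => //.
  + by rewrite (satA (b, u)) ?inE ?eqxx.
  + by rewrite (satB (b, u)) ?inE ?eqxx.
  + by rewrite (satA (y, v)) ?inE ?eqxx ?orbT.
  + by rewrite (satB (y, v)) ?inE ?eqxx ?orbT.
  + apply: leq_trans cc _; rewrite -addnA leq_add2l.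
    apply: (@leq_trans #|[set w in [seq w <- [:: u; v] | w \in cut A B]]|).
      by apply/subset_leq_card/subsetP => w; rewrite in_setI !in_set mem_filter => /andP[wc ->]; rewrite in_cut -negb_or wc.
    rewrite cardsE; apply: leq_trans (card_size _) _.
    by rewrite size_filter /= addn0.
Qed.
End Obstructions.

(** * Excluded configurations *)

Definition well_formed (F : frame) : bool :=
  [&& names F <= 14, uniq (map fst (closed_nbhds F)),
      all (fun e => (e.1 < names F) && (e.2 < names F)) (known_edges F)
    & all (fun c => (c.1 < names F) && all (fun j => j < names F) c.2) (closed_nbhds F)].

Definition extend F (es : seq (nat * nat)) cs : frame :=
  Frame (names F) (es ++ known_edges F) (cs ++ closed_nbhds F).

Definition add_name F : frame := Frame (names F).+1 (known_edges F) (closed_nbhds F).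

(** * Graphs that realize a frame *)

Section Realization.
Variable G : sgraph.
Variable x0 : G.
Implicit Types (F : frame) (vs : seq G) (A B : {set G}).

Definition realizes F vs : Prop :=
  [/\ size vs = names F, uniq vs,
      forall e, e \in known_edges F -> adj (nth x0 vs e.1) (nth x0 vs e.2)
    & forall c, c \in closed_nbhds F -> forall v, adj (nth x0 vs c.1) v ->
        v \in [seq nth x0 vs j | j <- c.2]].

(** Makes a symmetry of the configuration, such as exchanging u with v, a computation: known edges
    may be reversed, and closed lists may grow, since they only need to contain the neighbours. *)
Definition reindexes F F' (s : seq nat) : bool :=
  [&& size s == names F', uniq s, all (fun j => j < names F) s,
      all (fun e => let e' := (nth 0 s e.1, nth 0 s e.2) in
             (e' \in known_edges F) || ((e'.2, e'.1) \in known_edges F)) (known_edges F')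
    & all (fun c' => has (fun c => (c.1 == nth 0 s c'.1) &&
             all (mem [seq nth 0 s j | j <- c'.2]) c.2) (closed_nbhds F)) (closed_nbhds F')].

Lemma realizes_reindex F F' s vs : well_formed F' -> reindexes F F' s ->
  realizes F vs -> realizes F' [seq nth x0 vs j | j <- s].
Proof.
case/and4P=> _ _ /allP wfe /allP wfc /and5P[/eqP szs us /allP sF /allP es /allP cs].
case=> szvs uvs vse vsc; have nths j : j < names F' ->
    nth x0 [seq nth x0 vs j | j <- s] j = nth x0 vs (nth 0 s j).
  by move=> jF; rewrite (nth_map 0) ?szs.
split.
- by rewrite size_map.
- rewrite map_inj_in_uniq // => i j /sF iF /sF jF /eqP.
  by rewrite nth_uniq ?szvs // => /eqP.
- move=> e eF; have /andP[e1 e2] := wfe _ eF; rewrite !nths //.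
  by case/orP: (es _ eF) => /vse //=; rewrite adj_sym.
- move=> c' cF v; have /andP[c1 c2] := wfc _ cF; rewrite nths //.
  have /hasP[c cF' /andP[/eqP <- /allP cc]] := cs _ cF.
  move=> /(vsc _ cF')/mapP[j /cc/mapP[i ic ->] ->]; apply/mapP; exists i => //.
  by rewrite nths //; apply: (allP c2).
Qed.

Hypothesis qG : quasi_connected G 5.
Hypothesis card_G : 14 <= #|G|.

(** The side bounds are returned with the placement: where a surviving placement has two names on a
    side with bound 2, that side is known completely. *)
Lemma search_sound F vs (allowed : seq (seq place)) k A B :
  well_formed F -> realizes F vs -> sep A B -> 1 < #|A| -> 1 < #|B| ->
  #|cut A B| <= k -> size allowed = names F ->
  all (fun p => place_of A B p.1 \in p.2) (zip vs allowed) ->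
  let s := map (place_of A B) vs in
  s \in survivors F (nth [::] allowed) k /\
  forall b, minn #|side_set A B b| 14 <= side_bound k (closed_masks F) s b.
Proof.
move=> wf [szvs uvs vse vsc] sAB cA cB ck sza alw s.
have /and4P[F14 cu /allP wfe /allP wfc] := wf.
have f_inj i j : i < names F -> j < names F -> nth x0 vs i = nth x0 vs j -> i = j.
  by move=> iF jF /eqP; rewrite nth_uniq ?szvs // => /eqP.
have f_closed c : c \in closed_nbhds F -> forall v, adj (nth x0 vs c.1) v ->
    exists2 j, (j \in c.2) && (j < names F) & v = nth x0 vs j.
  move=> cF v /(vsc _ cF)/mapP[j jc ->]; exists j => //; rewrite jc.
  by have /andP[_ /allP] := wfc _ cF; apply.
have f_allowed i : i < names F -> place_of A B (nth x0 vs i) \in nth [::] allowed i.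
  move=> iF; have : (nth x0 vs i, nth [::] allowed i) \in zip vs allowed.
    by rewrite -nth_zip ?mem_nth ?size_zip ?sza ?szvs ?minnn.
  by move/(allP alw).
have -> : s = placement (nth x0 vs) A B (names F).
  apply: (@eq_from_nth _ None); first by rewrite size_map size_mkseq.
  by move=> i; rewrite size_map szvs => iF; rewrite (nth_map x0) ?szvs // nth_mkseq.
split; first exact: survivors_sound.
by move=> b; apply: side_boundP.
Qed.
End Realization.

Lemma place_cut (G : sgraph) (A B : {set G}) v : v \in cut A B -> place_of A B v = None.
Proof. by rewrite in_cut /place_of => /andP[/negbTE-> /negbTE->]. Qed.

(** * The frames searched and their surviving placements *)

Section Frames.
Local Notation P := (Some true).
Local Notation Q := (Some false).
Local Notation K := (@None bool).
Local Notation anywhere := [:: P; K; Q].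

(** The vertices x, a, b, c, d, y, t, u, v, w, z are numbered from 0 to 10; number 11
    is the vertex r of [frameA], resp. the common neighbour k of c and d in [frameC].
    In [merged_frame] u = w, and z has number 9. *)
Definition base_edges : seq (nat * nat) :=
  [:: (0, 1); (0, 2); (0, 3); (0, 4); (1, 2); (2, 3); (3, 4); (1, 4); (1, 5); (2, 6);
      (4, 5); (5, 9); (5, 10); (3, 6); (6, 7); (6, 8)].

Definition base_closed : seq (nat * seq nat) :=
  [:: (0, [:: 1; 2; 3; 4]); (1, [:: 0; 2; 4; 5; 9; 10]); (2, [:: 0; 1; 3; 6; 7; 8]);
      (5, [:: 1; 4; 9; 10]); (6, [:: 2; 3; 7; 8])].

Definition base_frame := Frame 11 base_edges base_closed.

Definition merged_frame := Frame 10
  [:: (0, 1); (0, 2); (0, 3); (0, 4); (1, 2); (2, 3); (3, 4); (1, 4); (1, 5); (2, 6);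
      (4, 5); (5, 7); (5, 9); (3, 6); (6, 7); (6, 8)]
  [:: (0, [:: 1; 2; 3; 4]); (1, [:: 0; 2; 4; 5; 7; 9]); (2, [:: 0; 1; 3; 6; 7; 8]);
      (5, [:: 1; 4; 7; 9]); (6, [:: 2; 3; 7; 8])].

Definition frameA := extend (add_name base_frame)
  [:: (1, 9); (2, 7); (7, 9); (9, 11); (7, 11)]
  [:: (9, [:: 1; 5; 7; 11]); (7, [:: 2; 6; 9; 11])].

Definition frameC := extend (add_name base_frame) [:: (3, 11); (4, 11)]
  [:: (3, [:: 0; 2; 4; 6; 11]); (4, [:: 0; 1; 3; 5; 11])].

Definition frameC1 := extend frameC [:: (2, 7); (2, 8)] [::].

Definition frameC0 := Frame 12 ((2, 7) :: known_edges frameC)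
  [:: (0, [:: 1; 2; 3; 4]); (1, [:: 0; 2; 4; 5; 9; 10]); (2, [:: 0; 1; 3; 6; 7]);
      (5, [:: 1; 4; 9; 10]); (6, [:: 2; 3; 7; 8]); (3, [:: 0; 2; 4; 6; 11]);
      (4, [:: 0; 1; 3; 5; 11])].

(** As c and d are adjacent, the sides can be named so that neither lies on the side [Q]. *)
Definition triangle_allowed : seq (seq place) :=
  [:: [:: K]; [:: K]; [:: K]; [:: P; K]; [:: P; K]] ++ nseq 6 anywhere.

(** The first four placements have x, a, b, y, t in the cut and one of u, v together with one of w,
    z on [Q]; they differ by exchanging u with v or w with z. The last one has c, d against u, v, w,
    z. *)
Lemma survivors_base : survivors base_frame (nth [::] triangle_allowed) 6 =
  [:: [:: K; K; K; P; P; K; K; P; Q; P; Q]; [:: K; K; K; P; P; K; K; P; Q; Q; P];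
      [:: K; K; K; P; P; K; K; Q; P; P; Q]; [:: K; K; K; P; P; K; K; Q; P; Q; P];
      [:: K; K; K; P; P; K; K; Q; Q; Q; Q]].
Proof. by vm_compute. Qed.

Lemma survivors_merged :
  survivors merged_frame (nth [::] (take 10 triangle_allowed)) 6 = [::].
Proof. by vm_compute. Qed.

Definition allowedA : seq (seq place) :=
  [:: P; K] :: nseq 4 anywhere ++ [:: [:: K]] ++ nseq 4 anywhere ++ [:: [:: K]; anywhere].

(** The cut comes from contracting yz. Here w and r are alone among the names on [Q], and the cut
    contains a, y, u, z and room for one more vertex. *)
Lemma survivorsA : survivors frameA (nth [::] allowedA) 5 =
  [:: [:: P; K; P; P; P; K; P; K; P; Q; K; Q]].
Proof. by vm_compute. Qed.

Definition allowedC1 : seq (seq place) :=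
  [:: [:: P; K]; anywhere; anywhere; [:: K]; anywhere; anywhere; [:: K]] ++ nseq 5 anywhere.

Lemma survivorsC1 : survivors frameC1 (nth [::] allowedC1) 5 = [::].
Proof. by vm_compute. Qed.

(** A pulled back cut is a union of classes, so b and u share their options, and likewise t and
    v. *)
Definition allowedC0 (pb pt : seq place) : seq (seq place) :=
  [:: [:: P; K]; anywhere; pb; anywhere; anywhere; anywhere; pt; pb; pt] ++ nseq 3 anywhere.

Lemma survivorsC0_KK : survivors frameC0 (nth [::] (allowedC0 [:: K] [:: K])) 6 = [::].
Proof. by vm_compute. Qed.

Lemma survivorsC0_PK : survivors frameC0 (nth [::] (allowedC0 [:: P; Q] [:: K])) 5 = [::].
Proof. by vm_compute. Qed.

(** The only placements left have the side {t, v}, which is a single vertex once tv is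
    contracted. *)
Lemma survivorsC0_KP :
  all (fun s => (indices frameC0 (mask_of s Q) == [:: 6; 8]) &&
                (side_bound 5 (closed_masks frameC0) s false == 2))
    (survivors frameC0 (nth [::] (allowedC0 [:: K] [:: P; Q])) 5).
Proof. by vm_compute. Qed.
End Frames.

(** * Counting neighbours, and facts about named vertices *)

Lemma card_setI_seq (T : finType) (X : {set T}) (s : seq T) :
  #|X :&: [set w in s]| <= count (mem X) s.
Proof.
apply: (@leq_trans #|[set w in [seq w <- s | w \in X]]|).
  by apply/subset_leq_card/subsetP => w; rewrite !inE mem_filter.
by rewrite cardsE -size_filter card_size.
Qed.

Section Neighbourhoods.
Variable G : sgraph.
Implicit Types (v : G) (s : seq G) (A B : {set G}).

Lemma full_nbhd v s : (forall w, adj v w -> w \in s) -> size s <= deg v ->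
  forall w, w \in s -> adj v w.
Proof.
move=> vs ds w ws; have sub : nbhd v \subset [set w in s].
  by apply/subsetP => u; rewrite !inE; apply: vs.
have : nbhd v == [set w in s].
  by rewrite eqEcard sub /= cardsE; apply: leq_trans ds; apply: card_size.
by move/eqP/setP/(_ w); rewrite !inE ws.
Qed.

Lemma deg_le_size v s : (forall w, adj v w -> w \in s) -> deg v <= size s.
Proof.
move=> vs; apply: leq_trans (card_size s).
by apply/subset_leq_card/subsetP => u; rewrite inE; apply: vs.
Qed.

Lemma outer_nbhd v s m : m + count (adj v) s <= deg v ->
  m <= #|nbhd v :\: [set w in s]|.
Proof.
have := cardsID [set w in s] (nbhd v); have := card_setI_seq (nbhd v) s.
have -> : count (mem (nbhd v)) s = count (adj v) s.
  by apply: eq_count => w; rewrite /= inE.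
rewrite /deg; lia.
Qed.

Lemma nbhd_complete v s : uniq s -> (forall w, w \in s -> adj v w) -> deg v <= size s ->
  forall w, adj v w -> w \in s.
Proof.
move=> us vs ds w; have sub : [set u in s] \subset nbhd v.
  by apply/subsetP => u; rewrite !inE; apply: vs.
have : [set u in s] == nbhd v.
  by rewrite eqEcard sub [X in _ <= X]cardsE (card_uniqP _).
by move/eqP/setP/(_ w); rewrite !inE => ->.
Qed.

Lemma nbhd_bound v s l (K0 : {set G}) :
  (forall w, adj v w -> (w \in s) || (w \in K0)) -> uniq l -> {subset l <= K0} ->
  (forall w, w \in l -> ~~ adj v w) -> deg v + size l <= size s + #|K0|.
Proof.
move=> vs ul lK vl; pose L := [set w in l].
have cL : #|L| = size l by rewrite cardsE; apply/card_uniqP.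
have cKL : #|K0 :\: L| + size l = #|K0|.
  rewrite -cL -(cardsID L K0) addnC (setIidPr _) //.
  by apply/subsetP => w; rewrite inE => /lK.
rewrite -cKL addnA leq_add2r.
apply: (@leq_trans #|[set w in s] :|: (K0 :\: L)|).
  apply/subset_leq_card/subsetP => w; rewrite !inE => vw.
  case/orP: (vs _ vw) => [->//|->]; rewrite andbT; apply/orP; right.
  by apply: contraL vw; apply: vl.
apply: leq_trans (leq_card_setU _ _) _; rewrite leq_add2r cardsE.
exact: card_size.
Qed.

Lemma place_anywhere A B v : place_of A B v \in [:: Some true; None; Some false].
Proof. by rewrite /place_of; case: (v \in A); case: (v \in B). Qed.

Lemma place_notin A B v : v \notin B -> place_of A B v \in [:: Some true; None].
Proof. by rewrite /place_of => /negbTE->; case: (v \in A). Qed.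

Lemma place_left A B v : place_of A B v = Some true -> v \in A.
Proof. by rewrite /place_of; case: (v \in A); case: (v \in B). Qed.

Lemma place_right A B v : place_of A B v = Some false -> v \in B.
Proof. by rewrite /place_of; case: (v \in A); case: (v \in B). Qed.

Lemma sep_nbr A B v w : sep A B -> v \in B -> adj v w -> w \in B :|: cut A B.
Proof.
case/sepP=> _ nAB vB vw; rewrite in_setU in_cut; case: (w \in B) => //=.
by rewrite andbT; apply: contraL vw => wA; rewrite adj_sym nAB.
Qed.

Lemma set2_of_card B p q : p != q -> p \in B -> q \in B -> #|B| <= 2 -> B = [set p; q].
Proof.
move=> pq pB qB cB; apply/esym/eqP; rewrite eqEcard cards2 pq subUset !sub1set pB qB.
exact: cB.
Qed.

Lemma cut_extra (K0 : {set G}) s v w : uniq s -> {subset s <= K0} -> #|K0| <= (size s).+1 ->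
  v \in K0 -> v \notin s -> w \in K0 -> w \in v :: s.
Proof.
move=> us sK cK vK vs wK.
have sub : [set u in v :: s] \subset K0.
  by apply/subsetP => u; rewrite !inE => /orP[/eqP->//|/sK].
have : [set u in v :: s] == K0.
  rewrite eqEcard sub cardsE (card_uniqP _) //=; by rewrite vs.
by move/eqP/setP/(_ w); rewrite wK inE => ->.
Qed.
End Neighbourhoods.

Definition boundary_check F (s t : seq nat) : bool :=
  [&& uniq (s ++ t), all (fun i => i < names F) (s ++ t), 1 < size s, size s <= 8,
      size t <= 4
    & all (fun i => has (fun c => (c.1 == i) && all (mem (s ++ t)) c.2) (closed_nbhds F)) s].

Section Named.
Variables (G : sgraph) (x0 : G) (F : frame) (vs : seq G).
Hypothesis wfF : well_formed F.
Hypothesis R : realizes x0 F vs.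
Local Notation nm := (nth x0 vs).
Implicit Types (A B : {set G}) (v : G).

Lemma named_inj i j : i < names F -> j < names F -> nm i = nm j -> i = j.
Proof. by case: R => sz u _ _ iF jF /eqP; rewrite nth_uniq ?sz // => /eqP. Qed.

Lemma mem_named i l : i < names F -> all (fun j => j < names F) l ->
  (nm i \in [seq nm j | j <- l]) = (i \in l).
Proof.
move=> iF /allP lF; apply/mapP/idP => [[j jl]|il]; last by exists i.
by move/(named_inj iF (lF _ jl)) ->.
Qed.

Lemma uniq_named l : uniq l -> all (fun j => j < names F) l -> uniq [seq nm j | j <- l].
Proof.
move=> ul /allP lF; rewrite map_inj_in_uniq // => i j /lF iF /lF jF.
exact: named_inj.
Qed.

Lemma named_adj i j : ((i, j) \in known_edges F) || ((j, i) \in known_edges F) ->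
  adj (nm i) (nm j).
Proof. by case: R => _ _ e _ /orP[/e|/e] //=; rewrite adj_sym. Qed.

Lemma named_nbr i l v : (i, l) \in closed_nbhds F -> adj (nm i) v ->
  v \in [seq nm j | j <- l].
Proof. by case: R => _ _ _ c /c; apply. Qed.

Lemma named_nonadj i l j : (i, l) \in closed_nbhds F -> j < names F -> j \notin l ->
  ~~ adj (nm i) (nm j).
Proof.
move=> il jF jl; apply/negP => /(named_nbr il).
case/and4P: wfF => _ _ _ /allP/(_ _ il)/= /andP[_ lF].
by rewrite mem_named // (negbTE jl).
Qed.

Lemma named_common i l i' l' v : (i, l) \in closed_nbhds F -> (i', l') \in closed_nbhds F ->
  adj (nm i) v -> adj (nm i') v -> v \in [seq nm j | j <- [seq j <- l | j \in l']].
Proof.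
move=> il il' iv iv'; have /mapP[j jl vj] := named_nbr il iv.
have := named_nbr il' iv'; case/and4P: wfF => _ _ _ /allP wc.
have /andP[_ lF] := wc _ il; have /andP[_ lF'] := wc _ il'.
rewrite vj mem_named //; last exact: (allP lF).
by move=> jl'; apply: map_f; rewrite mem_filter jl'.
Qed.

Lemma realizes_extend es cs :
  (forall e, e \in es -> adj (nm e.1) (nm e.2)) ->
  (forall c, c \in cs -> forall v, adj (nm c.1) v -> v \in [seq nm j | j <- c.2]) ->
  realizes x0 (extend F es cs) vs.
Proof.
case: R => sz u e c es' cs'; split=> // p; rewrite mem_cat => /orP[].
- exact: es'.
- exact: e.
- exact: cs'.
- exact: c.
Qed.

Lemma realizes_add_name v : v \notin vs -> realizes x0 (add_name F) (rcons vs v).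
Proof.
case: R => sz u e c vvs; have nthE i : i < names F -> nth x0 (rcons vs v) i = nm i.
  by move=> iF; rewrite nth_rcons sz iF.
case/and4P: wfF => _ _ /allP we /allP wc; split.
- by rewrite size_rcons sz.
- by rewrite rcons_uniq vvs.
- by move=> p pF; have /andP[p1 p2] := we _ pF; rewrite !nthE //; apply: e.
- move=> p pF w; have /andP[p1 /allP p2] := wc _ pF; rewrite nthE // => /(c _ pF).
  by case/mapP=> j jp ->; apply/mapP; exists j => //; rewrite nthE // p2.
Qed.

Hypothesis qG : quasi_connected G 5.
Hypothesis card_G : 14 <= #|G|.

Lemma named_boundary s t : boundary_check F s t -> False.
Proof.
case/and5P=> ust stF s1 s8 /andP[t4 /allP sc].
have := uniq_named ust stF; rewrite map_cat cat_uniq => /and3P[us dst _].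
apply: (@small_boundary G qG card_G (map nm s) (map nm t)); rewrite ?size_map //.
  by rewrite has_sym.
move=> _ w /mapP[i /sc/hasP[[i' l] il /andP[/eqP /= ii /allP lst]] ->].
rewrite -ii => /(named_nbr il)/mapP[j /lst jst ->].
by rewrite -map_cat; apply: map_f.
Qed.
End Named.

(** * Coinciding names, and the side {u, w} *)

Section Configurations.
Variable G : sgraph.
Hypothesis qG : quasi_connected G 5.
Hypothesis card_G : 14 <= #|G|.
Hypothesis no_contractible : forall H : subgraph G,
  1 <= #|sub_edges H| <= 3 -> ~~ quasi_contractible H 5.
Implicit Types (A B : {set G}).

Let star := @star_obstruction G qG card_G no_contractible.
Let deg4 (v : G) := deg_ge4 qG card_G v.

(** Allows the sides to be exchanged so that two adjacent vertices both avoid the second one, which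
    halves the searches. *)
Lemma place_split A B (p q : G) : sep A B -> adj p q ->
  (p \notin A /\ q \notin A) \/ (p \notin B /\ q \notin B).
Proof.
case/sepP=> dAB nAB pq; have dis u : u \in A -> u \notin B.
  by move=> uA; apply/negP => uB; have := pred0P dAB u; rewrite /= uA uB.
case: (boolP (p \in A)) => pA.
  right; split; first exact: dis.
  by apply/negP => qB; case/negP: (nAB _ _ pA qB).
case: (boolP (q \in A)) => qA; last by left.
right; split; last exact: dis.
by apply/negP => pB; case/negP: (nAB _ _ qA pB); rewrite adj_sym.
Qed.

(** Here u may be adjacent to both a and b, and contracting xab could then lower its degree to 3. In
    that case N(u) = {a, b, y, t}, and {x, a, b, y, t, u} is enclosed by c, d, v, z. Otherwise the
    degrees are fine, and no cut survives the search. *)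
Lemma merged_contradiction (x a b c d y t u v z : G) :
  realizes x merged_frame [:: x; a; b; c; d; y; t; u; v; z] ->
  4 < deg c -> 4 < deg d -> False.
Proof.
set vs := [:: x; _; _; _; _; _; _; _; _; _] => R dc dd.
have wf : well_formed merged_frame by [].
have Adj i j := named_adj R (i := i) (j := j).
have Non i l j := named_nonadj wf R (i := i) (l := l) (j := j).
have nca : ~~ adj c a by rewrite adj_sym; apply: (Non 1 [:: 0; 2; 4; 5; 7; 9] 3).
have ndb : ~~ adj d b by rewrite adj_sym; apply: (Non 2 [:: 0; 1; 3; 6; 7; 8] 4).
have nxu : ~~ adj u x by rewrite adj_sym; apply: (Non 0 [:: 1; 2; 3; 4] 7).
apply: (star (p := x) (s := [:: a; b])) => //.
- exact: (uniq_named R (l := [:: 0; 1; 2])).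
- by move=> q; rewrite !inE => /orP[]/eqP->; [apply: (Adj 0 1) | apply: (Adj 0 2)].
- move=> q; rewrite !inE !negb_or => /and3P[qx qa qb]; apply: outer_nbhd => /=.
  have d4 := deg4 q.
  case: (boolP (adj q x)) => qx' /=.
    have : q \in [:: a; b; c; d].
      by apply: (named_nbr R (i := 0) (l := [:: 1; 2; 3; 4])); rewrite // adj_sym.
    rewrite !inE (negbTE qa) (negbTE qb) /= => /orP[]/eqP->.
      by apply: leq_trans dc; rewrite (negbTE nca); case: (adj c b).
    by apply: leq_trans dd; rewrite (negbTE ndb); case: (adj d a).
  case: (boolP (adj q a)) => qa'; last by apply: leq_trans d4; case: (adj q b).
  case: (boolP (adj q b)) => qb'; last exact: leq_trans d4.
  have : q \in [:: x; u].
    by apply: (named_common wf R (i := 1) (l := [:: 0; 2; 4; 5; 7; 9])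
      (i' := 2) (l' := [:: 0; 1; 3; 6; 7; 8])); rewrite // adj_sym.
  rewrite !inE (negbTE qx) /= => /eqP qu; rewrite {}qu in d4 qa' qb' *.
  rewrite ltnNge; apply/negP => du4.
  have Nu : forall w, w \in nbhd u -> w \in [:: a; b; y; t].
    have sub : [set w in [:: a; b; y; t]] \subset nbhd u.
      apply/subsetP => w; rewrite !inE => /or4P[]/eqP-> //; rewrite adj_sym.
        exact: (Adj 5 7).
      exact: (Adj 6 7).
    have : [set w in [:: a; b; y; t]] == nbhd u.
      rewrite eqEcard sub [X in _ <= X]cardsE (card_uniqP _) //.
      exact: (uniq_named R (l := [:: 1; 2; 5; 6])).
    by move/eqP/setP => e w; rewrite -e inE.
  pose F := extend merged_frame [::] [:: (7, [:: 1; 2; 5; 6])].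
  have RF : realizes x F vs.
    apply: realizes_extend => // p; rewrite inE => /eqP-> w uw.
    by apply: Nu; rewrite inE.
  by apply: (@named_boundary _ _ F _ RF qG card_G [:: 0; 1; 2; 5; 6; 7] [:: 3; 4; 8; 9]).
- have main A B : sep A B -> 1 < #|A| -> 1 < #|B| -> {subset [:: x; a; b] <= cut A B} ->
      #|cut A B| <= 6 -> c \notin B -> d \notin B -> False.
    move=> sAB cA cB sK cK cB' dB'.
    have [px pa pb] : [/\ place_of A B x = None, place_of A B a = None & place_of A B b = None].
      by split; apply/place_cut/sK; rewrite !inE eqxx ?orbT.
    have [] := search_sound qG card_G (allowed := take 10 triangle_allowed) wf R sAB cA cB cK erefl.
      by rewrite /= px pa pb !place_anywhere !place_notin.
    by rewrite survivors_merged.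
  move=> A B sAB cA cB sK cK; have [[cA' dA']|[cB' dB']] := place_split sAB (Adj 3 4 isT).
    by apply: (main B A); rewrite 1?sep_sym 1?cut_sym // => q qs; rewrite cut_sym sK.
  exact: (main A B).
Qed.

(** If yz is not contractible, the search gives a 5-cut with side {w, r}. The neighbours of r are
    then among w and the cut, and r misses a and y, which leaves at most 1 + 3; missing z as well
    would leave only 3. *)
Lemma caseA_edge (x a b c d y t u v w z r : G) :
  realizes x frameA [:: x; a; b; c; d; y; t; u; v; w; z; r] ->
  4 < deg a -> 4 < deg d -> adj r z /\ deg r <= 4.
Proof.
set vs := [:: x; _; _; _; _; _; _; _; _; _; _; _] => R da dd.
have wf : well_formed frameA by [].
have Adj i j := named_adj R (i := i) (j := j).
have Non i l j := named_nonadj wf R (i := i) (l := l) (j := j).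
have nwz : ~~ adj w z by apply: (Non 9 [:: 1; 5; 7; 11] 10).
apply/andP; case: (boolP (adj r z && _)) => // bad; exfalso.
apply: (star (p := y) (s := [:: z])) => //.
- exact: (uniq_named R (l := [:: 5; 10])).
- by move=> q; rewrite !inE => /eqP->; apply: (Adj 5 10).
- move=> q; rewrite !inE !negb_or => /andP[qy qz]; apply: outer_nbhd => /=.
  have d4 := deg4 q.
  case: (boolP (adj q y)) => qy' /=; last by apply: leq_trans d4; case: (adj q z).
  have : q \in [:: a; d; w; z].
    by apply: (named_nbr R (i := 5) (l := [:: 1; 4; 9; 10])); rewrite // adj_sym.
  rewrite !inE (negbTE qz) orbF => /or3P[]/eqP qE; rewrite qE in d4 *.
  + by apply: leq_trans da; case: (adj a z).
  + by apply: leq_trans dd; case: (adj d z).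
  + by apply: leq_trans d4; rewrite (negbTE nwz).
- have main A B : sep A B -> 1 < #|A| -> 1 < #|B| -> {subset [:: y; z] <= cut A B} ->
      #|cut A B| <= 5 -> x \notin B -> False.
    move=> sAB cA cB sK cK xB.
    have [py pz] : place_of A B y = None /\ place_of A B z = None.
      by split; apply/place_cut/sK; rewrite !inE eqxx ?orbT.
    have [] := search_sound qG card_G (allowed := allowedA) wf R sAB cA cB cK erefl.
      by rewrite /= py pz !place_anywhere place_notin.
    rewrite survivorsA mem_seq1 => /eqP e /(_ false); rewrite e.
    have -> : side_bound 5 (closed_masks frameA) [:: Some true; None; Some true; Some true;
      Some true; None; Some true; None; Some true; Some false; None; Some false] false = 2.
      by vm_compute.
    case: e => _ pa _ _ _ _ _ pu _ /place_right wB _ /place_right rB cB2.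
    have {}cB2 : #|B| <= 2 by move: cB2; rewrite /side_set geq_min orbF.
    have wr : w != r by apply/eqP => /(@named_inj _ _ _ _ R 9 11 isT isT).
    have defB := set2_of_card wr wB rB cB2.
    have kE q : place_of A B q = None -> q \in cut A B.
      by move/eqP; rewrite -in_middle.
    have Nr q : adj r q -> (q \in [:: w]) || (q \in cut A B).
      move=> rq; have := sep_nbr sAB rB rq; rewrite in_setU mem_seq1 {1}defB !inE.
      by case/orP=> [/orP[->//|/eqP qr]|->]; rewrite ?orbT //; move: rq; rewrite qr adj_irr.
    have nra : ~~ adj r a by rewrite adj_sym; apply: (Non 1 [:: 0; 2; 4; 5; 9; 10] 11).
    have nry : ~~ adj r y by rewrite adj_sym; apply: (Non 5 [:: 1; 4; 9; 10] 11).
    have d4 := deg4 r.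
    have b1 : deg r + 2 <= 1 + #|cut A B|.
      apply: (@nbhd_bound _ r [:: w] [:: a; y]) => //.
      + exact: (uniq_named R (l := [:: 1; 5])).
      + by move=> q; rewrite mem_seq2 => /orP[]/eqP->; apply: kE.
      + by move=> q; rewrite !inE => /orP[]/eqP->.
    move: bad; rewrite negb_and -ltnNge orbC => /orP[|nrz].
      by rewrite ltnNge -(leq_add2r 2) (leq_trans b1) // add1n ltnS.
    suff b2 : deg r + 3 <= 1 + #|cut A B|.
      by move: d4; rewrite ltnNge -(leq_add2r 3) (leq_trans b2) // add1n ltnS.
    apply: (@nbhd_bound _ r [:: w] [:: a; y; z]) => //.
    + exact: (uniq_named R (l := [:: 1; 5; 10])).
    + by move=> q; rewrite mem_seq3 => /or3P[]/eqP->; apply: kE.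
    + by move=> q; rewrite !inE => /or3P[]/eqP->.
  move=> A B sAB cA cB sK cK; have [[xA _]|[xB _]] := place_split sAB (Adj 0 1 isT).
    by apply: (main B A); rewrite 1?sep_sym 1?cut_sym // => q qs; rewrite cut_sym sK.
  exact: (main A B).
Qed.

(** The sides and the degree bound give N(w) = {a, y, u, r} and N(u) = {b, t, w, r}. Then
    [caseA_edge] and its mirror image give N(r) = {w, u, z, v}, and {x, a, b, y, t, u, w, r} is
    enclosed by c, d, v, z. *)
Lemma caseA_contradiction (x a b c d y t u v w z : G) A B :
  realizes x base_frame [:: x; a; b; c; d; y; t; u; v; w; z] ->
  4 < deg a -> 4 < deg b -> 4 < deg c -> 4 < deg d ->
  sep A B -> #|B| <= 2 -> u \in B -> w \in B ->
  {subset [:: x; a; b; y; t] <= cut A B} -> #|cut A B| <= 6 -> False.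
Proof.
set vs := [:: x; _; _; _; _; _; _; _; _; _; _] => R da db dc dd sAB cB uB wB sK cK.
have wf : well_formed base_frame by [].
have Adj i j := named_adj R (i := i) (j := j).
have Non i l j := named_nonadj wf R (i := i) (l := l) (j := j).
have uw : u != w by apply/eqP => /(@named_inj _ _ _ _ R 7 9 isT isT).
have defB := set2_of_card uw uB wB cB.
have nwx : ~~ adj w x by rewrite adj_sym; apply: (Non 0 [:: 1; 2; 3; 4] 9).
have nwb : ~~ adj w b by rewrite adj_sym; apply: (Non 2 [:: 0; 1; 3; 6; 7; 8] 9).
have nwt : ~~ adj w t by rewrite adj_sym; apply: (Non 6 [:: 2; 3; 7; 8] 9).
have nux : ~~ adj u x by rewrite adj_sym; apply: (Non 0 [:: 1; 2; 3; 4] 7).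
have nua : ~~ adj u a by rewrite adj_sym; apply: (Non 1 [:: 0; 2; 4; 5; 9; 10] 7).
have nuy : ~~ adj u y by rewrite adj_sym; apply: (Non 5 [:: 1; 4; 9; 10] 7).
have Nw q : adj w q -> (q == u) || (q \in cut A B).
  move=> wq; have := sep_nbr sAB wB wq; rewrite in_setU {1}defB !inE.
  by case/orP=> [/orP[->//|/eqP qr]|->]; rewrite ?orbT //; move: wq; rewrite qr adj_irr.
have Nu q : adj u q -> (q == w) || (q \in cut A B).
  move=> uq; have := sep_nbr sAB uB uq; rewrite in_setU {1}defB !inE.
  by case/orP=> [/orP[/eqP qr|->//]|->]; rewrite ?orbT //; move: uq; rewrite qr adj_irr.
(* The three vertices u, a, y cannot exhaust the at least four neighbours of w; a further one must
   be the sixth vertex of the cut. *)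
have [r wr rn] : exists2 r, adj w r & r \notin [:: u; a; y].
  case: (boolP [exists r, adj w r && (r \notin [:: u; a; y])]) => [/existsP[r /andP[]]|].
    by exists r.
  move/existsPn=> no; have := deg4 w; rewrite ltnNge (@deg_le_size _ w [:: u; a; y]) // => q wq.
  by have := no q; rewrite wq /= negbK.
move: rn; rewrite !inE !negb_or => /and3P[ru ra ry].
have rK : r \in cut A B by have := Nw _ wr; rewrite (negbTE ru).
have rs : r \notin [:: x; a; b; y; t].
  rewrite !inE !negb_or ra ry /=; apply/and3P; split.
  - by apply: contraNneq nwx => <-.
  - by apply: contraNneq nwb => <-.
  - by apply: contraNneq nwt => <-.
have cutE q : q \in cut A B -> q \in [:: r; x; a; b; y; t].
  by apply: cut_extra; rewrite // ; apply: (uniq_named R (l := [:: 0; 1; 2; 5; 6])).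
have Nw4 q : adj w q -> q \in [:: a; y; u; r].
  move=> wq; case/orP: (Nw _ wq) => [/eqP->|/cutE]; first by rewrite !inE eqxx !orbT.
  rewrite !inE => /or4P[/eqP->|/eqP qx|/eqP->|]; rewrite ?eqxx ?orbT //.
    by move: wq; rewrite qx (negbTE nwx).
  case/or3P=> /eqP qE; rewrite qE ?eqxx ?orbT //.
    by move: wq; rewrite qE (negbTE nwb).
  by move: wq; rewrite qE (negbTE nwt).
have Nu4 q : adj u q -> q \in [:: b; t; w; r].
  move=> uq; case/orP: (Nu _ uq) => [/eqP->|/cutE]; first by rewrite !inE eqxx !orbT.
  rewrite !inE => /or4P[/eqP->|/eqP qx|/eqP qa|]; rewrite ?eqxx ?orbT //.
  - by move: uq; rewrite qx (negbTE nux).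
  - by move: uq; rewrite qa (negbTE nua).
  case/or3P=> /eqP qE; rewrite qE ?eqxx ?orbT //.
  by move: uq; rewrite qE (negbTE nuy).
have Aw := full_nbhd Nw4 (deg4 w); have Au := full_nbhd Nu4 (deg4 u).
have rB : r \notin B by move: rK; rewrite in_cut => /andP[].
have rvs : r \notin vs.
  (* Were r one of c, d, v, z, these four would already enclose {x, a, b, y, t, u, w}. *)
  have inner j : j \in [:: 3; 4; 8; 10] -> r <> nth x vs j.
    move=> jl rj.
    pose F := extend base_frame [::] [:: (9, [:: 1; 5; 7; j]); (7, [:: 2; 6; 9; j])].
    have RF : realizes x F vs.
      apply: realizes_extend => // p; rewrite !inE => /orP[]/eqP-> q /=.
        by move/Nw4; rewrite rj.
      by move/Nu4; rewrite rj.
    apply: (@named_boundary _ _ F _ RF qG card_G [:: 0; 1; 2; 5; 6; 7; 9] [:: 3; 4; 8; 10]).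
    by move: jl; rewrite /F !inE => /or4P[]/eqP->.
  move: rs; rewrite !inE !negb_or => /and5P[-> -> -> -> ->] /=.
  have rw : r != w by apply: contraNneq rB => ->.
  rewrite ru rw /=; apply/and4P; split; apply/eqP.
  - exact: (inner 3).
  - exact: (inner 4).
  - exact: (inner 8).
  - exact: (inner 10).
have RA : realizes x frameA (rcons vs r).
  apply: realizes_extend; first exact: realizes_add_name.
    move=> e; rewrite !inE => /or4P[/eqP->|/eqP->|/eqP->|/orP[]/eqP->] /=.
    - by rewrite adj_sym Aw ?inE ?eqxx ?orbT.
    - by rewrite adj_sym Au ?inE ?eqxx ?orbT.
    - by rewrite Au ?inE ?eqxx ?orbT.
    - by rewrite Aw ?inE ?eqxx ?orbT.
    - by rewrite Au ?inE ?eqxx ?orbT.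
  by move=> p; rewrite !inE => /orP[]/eqP-> q /=; [apply: Nw4 | apply: Nu4].
have [rz r4] := caseA_edge RA da dd.
(* The reflection exchanges a with b, c with d, y with t, u with w and v with z; it turns the edge
   yz into tv. *)
have RM : realizes x frameA [:: x; b; a; d; c; t; y; w; z; u; v; r].
  exact: (@realizes_reindex _ _ frameA frameA [:: 0; 2; 1; 4; 3; 6; 5; 9; 10; 7; 8; 11] _ isT isT RA).
have [rv _] := caseA_edge RM db dc.
pose F := extend frameA [::] [:: (11, [:: 9; 7; 10; 8])].
have RF : realizes x F (rcons vs r).
  apply: realizes_extend => // p; rewrite inE => /eqP-> q /=.
  apply: (@nbhd_complete _ r [:: w; u; z; v]) => //.
    exact: (uniq_named R (l := [:: 9; 7; 10; 8])).
  move=> p'; rewrite !inE => /or4P[]/eqP-> //; rewrite adj_sym.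
    by rewrite Aw ?inE ?eqxx ?orbT.
  by rewrite Au ?inE ?eqxx ?orbT.
by apply: (@named_boundary _ _ F _ RF qG card_G [:: 0; 1; 2; 5; 6; 7; 9; 11] [:: 3; 4; 8; 10]).
Qed.
End Configurations.

(** * The side {c, d}, and the triangle *)

Section ConfigurationsC.
Variable G : sgraph.
Hypothesis qG : quasi_connected G 5.
Hypothesis card_G : 14 <= #|G|.
Hypothesis no_contractible : forall H : subgraph G,
  1 <= #|sub_edges H| <= 3 -> ~~ quasi_contractible H 5.
Implicit Types (A B : {set G}).

Let star := @star_obstruction G qG card_G no_contractible.
Let deg4 (v : G) := deg_ge4 qG card_G v.

(** Contracting ct can only cost b a neighbour, as b is the sole common neighbour of c and t and has
    degree at least 5; no cut through c and t survives the search. *)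
Lemma caseC1_contradiction (x a b c d y t u v w z k : G) :
  realizes x frameC1 [:: x; a; b; c; d; y; t; u; v; w; z; k] -> 4 < deg b -> False.
Proof.
set vs := [:: x; _; _; _; _; _; _; _; _; _; _; _] => R db.
have wf : well_formed frameC1 by [].
have Adj i j := named_adj R (i := i) (j := j).
apply: (star (p := c) (s := [:: t])) => //.
- exact: (uniq_named R (l := [:: 3; 6])).
- by move=> q; rewrite !inE => /eqP->; apply: (Adj 3 6).
- move=> q; rewrite !inE !negb_or => /andP[qc qt]; apply: outer_nbhd => /=.
  have d4 := deg4 q.
  case: (boolP (adj q c)) => qc' /=; last by apply: leq_trans d4; case: (adj q t).
  case: (boolP (adj q t)) => qt' /=; last exact: leq_trans d4.
  have : q \in [:: b].
    by apply: (named_common wf R (i := 3) (l := [:: 0; 2; 4; 6; 11])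
      (i' := 6) (l' := [:: 2; 3; 7; 8])); rewrite // adj_sym.
  by rewrite mem_seq1 => /eqP qE; rewrite qE in d4 *; apply: leq_trans db.
- have main A B : sep A B -> 1 < #|A| -> 1 < #|B| -> {subset [:: c; t] <= cut A B} ->
      #|cut A B| <= 5 -> x \notin B -> False.
    move=> sAB cA cB sK cK xB.
    have [pc pt] : place_of A B c = None /\ place_of A B t = None.
      by split; apply/place_cut/sK; rewrite !inE eqxx ?orbT.
    have [] := search_sound qG card_G (allowed := allowedC1) wf R sAB cA cB cK erefl.
      by rewrite /= pc pt !place_anywhere place_notin.
    by rewrite survivorsC1.
  move=> A B sAB cA cB sK cK; have [[xA _]|[xB _]] := place_split sAB (Adj 0 1 isT).
    by apply: (main B A); rewrite 1?sep_sym 1?cut_sym // => q qs; rewrite cut_sym sK.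
  exact: (main A B).
Qed.

(** Now b misses v, so bu and tv are contracted together. A bad cut must contain one of these edges,
    and by the search its only possible form has tv alone on a side. *)
Lemma caseC0_contradiction (x a b c d y t u v w z k : G) :
  realizes x frameC0 [:: x; a; b; c; d; y; t; u; v; w; z; k] -> False.
Proof.
set vs := [:: x; _; _; _; _; _; _; _; _; _; _; _] => R.
have wf : well_formed frameC0 by [].
have Adj i j := named_adj R (i := i) (j := j).
have Non i l j := named_nonadj wf R (i := i) (l := l) (j := j).
have neq i j : i < 12 -> j < 12 -> i != j -> nth x vs i != nth x vs j.
  by move=> iF jF; apply: contraNneq => /(named_inj R iF jF)->.
have bt : adj b t by apply: (Adj 2 6).
have tc : adj t c by apply: (Adj 6 3).
have bu : adj b u by apply: (Adj 2 7).
have tv : adj t v by apply: (Adj 6 8).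
apply: (two_edge_obstruction card_G no_contractible _ bu tv).
- exact: (uniq_named R (l := [:: 2; 7; 6; 8])).
- set phi := leaf_center _ => w0.
  have phiE q : phi q = if q == u then b else if q == v then t else q by [].
  have ub : (u == b) = false by apply/negbTE/(neq 7 2).
  have vb : (v == b) = false by apply/negbTE/(neq 8 2).
  have tb : (t == b) = false by apply/negbTE/(neq 6 2).
  have tu : (t == u) = false by apply/negbTE/(neq 6 7).
  have tv' : (t == v) = false by apply/negbTE/(neq 6 8).
  have cu : (c == u) = false by apply/negbTE/(neq 3 7).
  have cv : (c == v) = false by apply/negbTE/(neq 3 8).
  have vu : (v == u) = false by apply/negbTE/(neq 8 7).
  have bu' : (b == u) = false by rewrite eq_sym.
  have bv' : (b == v) = false by rewrite eq_sym.
  have phiF q : q != u -> q != v -> phi q = q.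
    by rewrite phiE => /negbTE-> /negbTE->.
  case: (boolP (phi w0 == b)) => [/eqP wb|wb].
    have sub : [set q in [:: x; a; c; t]] \subset phi @: class_nbhd phi w0.
      apply/subsetP => q; rewrite inE => qs; apply/imsetP.
      have [qb' [qu qv]] : q != b /\ q != u /\ q != v.
        move: qs; rewrite !inE => /or4P[]/eqP->; split; try split;
          [apply: (neq 0 2) | apply: (neq 0 7) | apply: (neq 0 8)
          |apply: (neq 1 2) | apply: (neq 1 7) | apply: (neq 1 8)
          |apply: (neq 3 2) | apply: (neq 3 7) | apply: (neq 3 8)
          |apply: (neq 6 2) | apply: (neq 6 7) | apply: (neq 6 8)] => //.
      exists q; last by rewrite phiF.
      rewrite inE phiF // wb qb' /=; apply/existsP; exists b.
      rewrite phiE bu' bv' eqxx /=; move: qs; rewrite !inE => /or4P[]/eqP->;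
        [apply: (Adj 2 0) | apply: (Adj 2 1) | apply: (Adj 2 3) | apply: (Adj 2 6)] => //.
    apply: leq_trans (subset_leq_card sub); rewrite cardsE (card_uniqP _) //.
    exact: (uniq_named R (l := [:: 0; 1; 3; 6])).
  case: (boolP (phi w0 == t)) => [/eqP wt|wt].
    pose Z := nbhd v :\: [set q in [:: t; u]].
    have nvb : ~~ adj v b by rewrite adj_sym; apply: (Non 2 [:: 0; 1; 3; 6; 7] 8).
    have nvc : ~~ adj v c by rewrite adj_sym; apply: (Non 3 [:: 0; 2; 4; 6; 11] 8).
    have cZ : 2 <= #|Z|.
      by apply: outer_nbhd => /=; apply: leq_trans (deg4 v); case: (adj v t); case: (adj v u).
    (* The class {t, v} sees b and c through t, and through v at least two further vertices, since v
       misses b and c. *)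
    have sub : b |: (c |: Z) \subset phi @: class_nbhd phi w0.
      apply/subsetP => q; rewrite in_setU1 in_setU1 => qs; apply/imsetP.
      case/or3P: qs => [/eqP->|/eqP->|].
      + exists b; last by rewrite phiE bu' bv'.
        rewrite inE wt phiE bu' bv' eq_sym tb /=; apply/existsP; exists t.
        by rewrite phiE tu tv' eqxx adj_sym.
      + exists c; last by rewrite phiE cu cv.
        rewrite inE wt phiE cu cv (neq 3 6) //=; apply/existsP; exists t.
        by rewrite phiE tu tv' eqxx.
      + rewrite !inE negb_or => /andP[/andP[qt qu] vq].
        have qv : q != v by apply: contraTneq vq => ->; rewrite adj_irr.
        exists q; last by rewrite phiF.
        rewrite inE phiF // wt qt /=; apply/existsP; exists v.
        by rewrite phiE vu eqxx eqxx.
    apply: leq_trans (subset_leq_card sub); rewrite !cardsU1 !inE.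
    by rewrite (negbTE nvb) (negbTE nvc) !andbF orbF (neq 2 3).
  have wu : w0 != u by apply: contraNneq wb => ->; rewrite phiE eqxx.
  have wv : w0 != v by apply: contraNneq wt => ->; rewrite phiE vu eqxx.
  rewrite phiF // in wb wt.
  have -> : class_nbhd phi w0 = nbhd w0.
    apply: star_class_nbhd; first exact: phiF.
    - by rewrite /= !inE negb_or wb wt.
    - by rewrite /= inE eq_sym vu.
    - by rewrite /= !inE negb_or wu wv.
  (* A vertex outside both edges is never adjacent to both ends of one of them, so its degree does
     not drop. *)
  rewrite card_in_imset ?deg4 // => p q; rewrite !inE => wp wq.
  have nbx : adj w0 u -> ~~ adj w0 b.
    move=> w0u; apply/negP => w0b.
    have : w0 \in [:: x; a; c; t; u].
      by apply: (named_nbr R (i := 2) (l := [:: 0; 1; 3; 6; 7])); rewrite // adj_sym.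
    rewrite !inE (negbTE wu) (negbTE wt) !orbF => /or3P[]/eqP wE; move: w0u; apply/negP; rewrite wE.
    - exact: (Non 0 [:: 1; 2; 3; 4] 7).
    - exact: (Non 1 [:: 0; 2; 4; 5; 9; 10] 7).
    - exact: (Non 3 [:: 0; 2; 4; 6; 11] 7).
  have ntx : adj w0 v -> ~~ adj w0 t.
    move=> w0v; apply/negP => w0t.
    have : w0 \in [:: b; c; u; v].
      by apply: (named_nbr R (i := 6) (l := [:: 2; 3; 7; 8])); rewrite // adj_sym.
    rewrite !inE (negbTE wu) (negbTE wv) (negbTE wb) !orbF /= => /eqP wE.
    by move: w0v; apply/negP; rewrite wE; apply: (Non 3 [:: 0; 2; 4; 6; 11] 8).
  rewrite !phiE; case: (eqVneq p u) => [pE|pu]; case: (eqVneq q u) => [qE|qu].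
  + by rewrite pE qE.
  + rewrite pE in wp; case: (eqVneq q v) => [_ /eqP|_ bq]; first by rewrite eq_sym tb.
    by move: (nbx wp); rewrite bq wq.
  + rewrite qE in wq; case: (eqVneq p v) => [_ /eqP|_ bq]; first by rewrite tb.
    by move: (nbx wq); rewrite -bq wp.
  case: (eqVneq p v) => [pE|pv]; case: (eqVneq q v) => [qE|qv] //.
  + by rewrite pE qE.
  + by rewrite pE in wp => tq; move: (ntx wp); rewrite tq wq.
  + by rewrite qE in wq => tp; move: (ntx wq); rewrite -tp wp.
- set phi := leaf_center _.
  have phit : phi t = t by rewrite /phi /= (negbTE (neq 6 7 _ _ _)) // (negbTE (neq 6 8 _ _ _)).
  have phiv : phi v = t by rewrite /phi /= (negbTE (neq 8 7 _ _ _)) // eqxx.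
  have main A B : sep A B -> (b \in A) = (u \in A) -> (b \in B) = (u \in B) ->
      (t \in A) = (v \in A) -> (t \in B) = (v \in B) -> 1 < #|phi @: A| -> 1 < #|phi @: B| ->
      #|cut A B| <= 4 + (u \in cut A B) + (v \in cut A B) -> x \notin B -> False.
    move=> sAB bA bB tA tB cpA cpB cK xB.
    have cA : 1 < #|A| by apply: leq_trans cpA (leq_imset_card _ _).
    have cB : 1 < #|B| by apply: leq_trans cpB (leq_imset_card _ _).
    have pbu : place_of A B b = place_of A B u by rewrite /place_of bA bB.
    have ptv : place_of A B t = place_of A B v by rewrite /place_of tA tB.
    have side q : q \notin cut A B -> place_of A B q \in [:: Some true; Some false].
      by rewrite in_cut /place_of; case: (q \in A); case: (q \in B).
    case: (boolP (u \in cut A B)) cK => uK; case: (boolP (v \in cut A B)) => vK cK.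
    + have pu := place_cut uK; have pv := place_cut vK.
      have [] := search_sound qG card_G (allowed := allowedC0 [:: None] [:: None])
        wf R sAB cA cB cK erefl.
        by rewrite /= ptv pbu pu pv !place_anywhere place_notin.
      by rewrite survivorsC0_KK.
    + have pu := place_cut uK; have pv := side v vK.
      have [] := search_sound qG card_G (allowed := allowedC0 [:: None] [:: Some true; Some false])
        wf R sAB cA cB cK erefl.
        by rewrite /= ptv pbu pu pv !place_anywhere place_notin.
      set s := map _ _ => sS bnd.
      have /andP[/eqP ix /eqP sb] := allP survivorsC0_KP s sS.
      have cB2 : #|B| <= 2 by have := bnd false; rewrite sb /side_set geq_min orbF.
      have tinB : t \in B.
        have : 6 \in indices frameC0 (mask_of s (Some false)) by rewrite ix.
        rewrite mem_indices => /andP[_].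
        by rewrite -[nth _ _ _]/(place_of A B t == Some false) => /eqP/place_right.
      have vinB : v \in B.
        have : 8 \in indices frameC0 (mask_of s (Some false)) by rewrite ix.
        rewrite mem_indices => /andP[_].
        by rewrite -[nth _ _ _]/(place_of A B v == Some false) => /eqP/place_right.
      have defB := set2_of_card (neq 6 8 isT isT isT) tinB vinB cB2.
      (* The side {t, v} has a one-element image, against the requirement of two vertices in the
         contraction. *)
      move: cpB; rewrite defB imsetU1 imset_set1 /= phit phiv setUid cards1.
      by [].
    + have pv := place_cut vK; have pu := side u uK.
      have [] := search_sound qG card_G (allowed := allowedC0 [:: Some true; Some false] [:: None])
        wf R sAB cA cB cK erefl.
        by rewrite /= ptv pbu pu pv !place_anywhere place_notin.
      by rewrite survivorsC0_PK.
    + have := quasi_connected5_nontrivial qG sAB cA cB.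
      by rewrite ltnNge cK.
  move=> A B sAB bA bB tA tB cA cB cK.
  have [[xA _]|[xB _]] := place_split sAB (Adj 0 1 isT).
    by apply: (main B A); rewrite 1?sep_sym 1?cut_sym.
  exact: (main A B).
Qed.

Lemma caseC_named (x a b c d y t u v w z k : G) :
  realizes x frameC [:: x; a; b; c; d; y; t; u; v; w; z; k] -> 4 < deg b -> adj b u -> False.
Proof.
set vs := [:: x; _; _; _; _; _; _; _; _; _; _; _] => R db bu.
case: (boolP (adj b v)) => bv.
  apply: (@caseC1_contradiction x a b c d y t u v w z k) => //.
  by apply: (realizes_extend R) => // e; rewrite !inE => /orP[]/eqP->.
apply: (@caseC0_contradiction x a b c d y t u v w z k).
pose F := extend frameC [:: (2, 7)] [:: (2, [:: 0; 1; 3; 6; 7])].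
have RF : realizes x F vs.
  apply: (realizes_extend R) => e; rewrite inE => /eqP-> // q bq.
  have := named_nbr R (i := 2) (l := [:: 0; 1; 3; 6; 7; 8]) isT bq.
  rewrite !inE; case/or4P=> [->|->|->|/or3P[->|->|/eqP qE]]; rewrite ?orbT //.
  by move: bq; rewrite /= qE (negbTE bv).
exact: (@realizes_reindex _ _ F frameC0 (iota 0 12) _ isT isT RF).
Qed.

(** The cut is {x, a, b, y, t} with at most one more vertex. Since c misses a and y, and d misses b
    and t, their degrees of at least 5 force a common neighbour k as sixth cut vertex and determine
    N(c) and N(d). The degree of b then yields a neighbour among u and v. *)
Lemma caseC_contradiction (x a b c d y t u v w z : G) A B :
  realizes x base_frame [:: x; a; b; c; d; y; t; u; v; w; z] ->
  4 < deg b -> 4 < deg c -> 4 < deg d ->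
  sep A B -> #|A| <= 2 -> c \in A -> d \in A -> {subset [:: u; v; w; z] <= B} ->
  {subset [:: x; a; b; y; t] <= cut A B} -> #|cut A B| <= 6 -> False.
Proof.
set vs := [:: x; _; _; _; _; _; _; _; _; _; _] => R db dc dd sAB cA cin din sB sK cK.
have wf : well_formed base_frame by [].
have Adj i j := named_adj R (i := i) (j := j).
have Non i l j := named_nonadj wf R (i := i) (l := l) (j := j).
have cd : c != d by apply/eqP => /(@named_inj _ _ _ _ R 3 4 isT isT).
have defA := set2_of_card cd cin din cA.
have nca : ~~ adj c a by rewrite adj_sym; apply: (Non 1 [:: 0; 2; 4; 5; 9; 10] 3).
have ncy : ~~ adj c y by rewrite adj_sym; apply: (Non 5 [:: 1; 4; 9; 10] 3).
have ndb : ~~ adj d b by rewrite adj_sym; apply: (Non 2 [:: 0; 1; 3; 6; 7; 8] 4).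
have ndt : ~~ adj d t by rewrite adj_sym; apply: (Non 6 [:: 2; 3; 7; 8] 4).
have sBA : sep B A by rewrite sep_sym.
have Nc q : adj c q -> (q == d) || (q \in cut A B).
  move=> cq; have := sep_nbr sBA cin cq; rewrite in_setU {1}defA [cut B A]cut_sym !inE.
  by case/orP=> [/orP[/eqP qr|->//]|->]; rewrite ?orbT //; move: cq; rewrite qr adj_irr.
have Nd q : adj d q -> (q == c) || (q \in cut A B).
  move=> dq; have := sep_nbr sBA din dq; rewrite in_setU {1}defA [cut B A]cut_sym !inE.
  by case/orP=> [/orP[->//|/eqP qr]|->]; rewrite ?orbT //; move: dq; rewrite qr adj_irr.
have [k ck kn] : exists2 k, adj c k & k \notin [:: x; b; d; t].
  case: (boolP [exists k, adj c k && (k \notin [:: x; b; d; t])]) => [/existsP[k /andP[]]|].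
    by exists k.
  move/existsPn=> no; move: dc; rewrite ltnNge (@deg_le_size _ c [:: x; b; d; t]) // => q cq.
  by have := no q; rewrite cq /= negbK.
move: kn; rewrite !inE !negb_or => /and4P[kx kb kd kt].
have kK : k \in cut A B by have := Nc _ ck; rewrite (negbTE kd).
have ka : k != a by apply: contraNneq nca => <-.
have ky : k != y by apply: contraNneq ncy => <-.
have cutE q : q \in cut A B -> q \in [:: k; x; a; b; y; t].
  apply: cut_extra => //; first exact: (uniq_named R (l := [:: 0; 1; 2; 5; 6])).
  by rewrite !inE !negb_or kx ka kb ky kt.
have Nc5 q : adj c q -> q \in [:: x; b; d; t; k].
  move=> cq; case/orP: (Nc _ cq) => [/eqP->|/cutE]; first by rewrite !inE eqxx !orbT.
  rewrite !inE => /or4P[/eqP->|/eqP->|/eqP qa|]; rewrite ?eqxx ?orbT //.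
    by move: cq; rewrite qa (negbTE nca).
  case/or3P=> /eqP qE; rewrite qE ?eqxx ?orbT //.
  by move: cq; rewrite qE (negbTE ncy).
have Nd5 q : adj d q -> q \in [:: x; a; c; y; k].
  move=> dq; case/orP: (Nd _ dq) => [/eqP->|/cutE]; first by rewrite !inE eqxx !orbT.
  rewrite !inE => /or4P[/eqP->|/eqP->|/eqP->|]; rewrite ?eqxx ?orbT //.
  case/or3P=> /eqP qE; rewrite qE ?eqxx ?orbT //.
    by move: dq; rewrite qE (negbTE ndb).
  by move: dq; rewrite qE (negbTE ndt).
have dk : adj d k by apply: (full_nbhd Nd5 dd); rewrite !inE eqxx !orbT.
have kAB : k \notin A /\ k \notin B by move: kK; rewrite in_cut => /andP[].
have kvs : k \notin vs.
  have kB q : q \in [:: u; v; w; z] -> k != q.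
    by move/sB => qB; apply: contraNneq (proj2 kAB) => ->.
  have kc : k != c by apply: contraNneq (proj1 kAB) => ->.
  rewrite !inE !negb_or kx ka kb kc kd ky kt /=.
  by rewrite !kB ?inE ?eqxx ?orbT.
have RC : realizes x frameC (rcons vs k).
  apply: (realizes_extend (realizes_add_name wf R kvs)).
    by move=> e; rewrite !inE => /orP[]/eqP->.
  by move=> e; rewrite !inE => /orP[]/eqP-> q /=; [move/Nc5|move/Nd5].
have Nb q : adj b q -> q \in [:: x; a; c; t; u; v].
  exact: (named_nbr R (i := 2) (l := [:: 0; 1; 3; 6; 7; 8])).
case: (boolP (adj b u)) => bu; first exact: (caseC_named RC db bu).
case: (boolP (adj b v)) => bv.
  apply: (@caseC_named x a b c d y t v u w z k) => //.
  exact: (@realizes_reindex _ _ frameC frameC [:: 0; 1; 2; 3; 4; 5; 6; 8; 7; 9; 10; 11] _ isT isT RC).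
move: db; rewrite ltnNge (@deg_le_size _ b [:: x; a; c; t]) // => q bq.
have := Nb _ bq; rewrite !inE => /or4P[->|->|->|/or3P[->|/eqP qE|/eqP qE]]; rewrite ?orbT //.
  by move: bq; rewrite qE (negbTE bu).
by move: bq; rewrite qE (negbTE bv).
Qed.

Lemma base_contradiction (x a b c d y t u v w z : G) :
  realizes x base_frame [:: x; a; b; c; d; y; t; u; v; w; z] ->
  4 < deg a -> 4 < deg b -> 4 < deg c -> 4 < deg d -> False.
Proof.
set vs := [:: x; _; _; _; _; _; _; _; _; _; _] => R da db dc dd.
have wf : well_formed base_frame by [].
have Adj i j := named_adj R (i := i) (j := j).
have Non i l j := named_nonadj wf R (i := i) (l := l) (j := j).
have nca : ~~ adj c a by rewrite adj_sym; apply: (Non 1 [:: 0; 2; 4; 5; 9; 10] 3).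
have ndb : ~~ adj d b by rewrite adj_sym; apply: (Non 2 [:: 0; 1; 3; 6; 7; 8] 4).
apply: (star (p := x) (s := [:: a; b])) => //.
- exact: (uniq_named R (l := [:: 0; 1; 2])).
- by move=> q; rewrite !inE => /orP[]/eqP->; [apply: (Adj 0 1) | apply: (Adj 0 2)].
- move=> q; rewrite !inE !negb_or => /and3P[qx qa qb]; apply: outer_nbhd => /=.
  have d4 := deg4 q.
  case: (boolP (adj q x)) => qx' /=.
    have : q \in [:: a; b; c; d].
      by apply: (named_nbr R (i := 0) (l := [:: 1; 2; 3; 4])); rewrite // adj_sym.
    rewrite !inE (negbTE qa) (negbTE qb) /= => /orP[]/eqP->.
      by apply: leq_trans dc; rewrite (negbTE nca); case: (adj c b).
    by apply: leq_trans dd; rewrite (negbTE ndb); case: (adj d a).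
  case: (boolP (adj q a)) => qa'; last by apply: leq_trans d4; case: (adj q b).
  case: (boolP (adj q b)) => qb'; last exact: leq_trans d4.
  have : q \in [:: x].
    by apply: (named_common wf R (i := 1) (l := [:: 0; 2; 4; 5; 9; 10])
      (i' := 2) (l' := [:: 0; 1; 3; 6; 7; 8])); rewrite // adj_sym.
  by rewrite mem_seq1 (negbTE qx).
- have main A B : sep A B -> 1 < #|A| -> 1 < #|B| -> {subset [:: x; a; b] <= cut A B} ->
      #|cut A B| <= 6 -> c \notin B -> d \notin B -> False.
    move=> sAB cA cB sK cK cB' dB'.
    have [px pa pb] : [/\ place_of A B x = None, place_of A B a = None & place_of A B b = None].
      by split; apply/place_cut/sK; rewrite !inE eqxx ?orbT.
    have [] := search_sound qG card_G (allowed := triangle_allowed) wf R sAB cA cB cK erefl.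
      by rewrite /= px pa pb !place_anywhere !place_notin.
    have kE q : place_of A B q = None -> q \in cut A B.
      by move/eqP; rewrite -in_middle.
    rewrite survivors_base => sS bnd.
    have sK5 : place_of A B y = None -> place_of A B t = None ->
        {subset [:: x; a; b; y; t] <= cut A B}.
      by move=> py pt q; rewrite !in_cons in_nil orbF => /or4P[/eqP->|/eqP->|/eqP->|/orP[]/eqP->];
        apply: kE.
    (* Serves the first four survivors, each after renaming so that the vertices on [Q] come first
       in their pairs. *)
    have bndA (u' v' w' z' : G) : place_of A B y = None -> place_of A B t = None ->
        realizes x base_frame [:: x; a; b; c; d; y; t; u'; v'; w'; z'] ->
        side_bound 6 (closed_masks base_frame) (map (place_of A B) vs) false = 2 ->
        place_of A B u' = Some false -> place_of A B w' = Some false -> False.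
      move=> py pt R' sb pu pw; have := bnd false; rewrite sb geq_min orbF => cB2.
      exact: (@caseA_contradiction _ qG card_G no_contractible x a b c d y t u' v' w' z' A B R'
        da db dc dd sAB cB2 (place_right pu) (place_right pw) (sK5 py pt) cK).
    have Ruv := @realizes_reindex _ _ base_frame base_frame [:: 0; 1; 2; 3; 4; 5; 6; 8; 7; 9; 10] _ isT isT R.
    have Rwz := @realizes_reindex _ _ base_frame base_frame [:: 0; 1; 2; 3; 4; 5; 6; 7; 8; 10; 9] _ isT isT R.
    have Ruvwz := @realizes_reindex _ _ base_frame base_frame [:: 0; 1; 2; 3; 4; 5; 6; 8; 7; 10; 9] _ isT isT R.
    move: sS; rewrite 4!in_cons mem_seq1 => /or4P[|||/orP[]] /eqP e;
      have := e; case=> _ _ _ pc pd py pt pu pv pw pz.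
    - by apply: (bndA v u z w) => //; rewrite e; vm_compute.
    - by apply: (bndA v u w z) => //; rewrite e; vm_compute.
    - by apply: (bndA u v z w) => //; rewrite e; vm_compute.
    - by apply: (bndA u v w z) => //; rewrite e; vm_compute.
    - have cA2 : #|A| <= 2.
        have sb : side_bound 6 (closed_masks base_frame) (map (place_of A B) vs) true = 2.
          by rewrite e; vm_compute.
        by have := bnd true; rewrite sb geq_min orbF.
      apply: (@caseC_contradiction x a b c d y t u v w z A B) => //.
      + exact: place_left pc.
      + exact: place_left pd.
      + by move=> q; rewrite !in_cons in_nil orbF => /or4P[]/eqP->; apply: (@place_right _ A B).
      + exact: sK5.
  move=> A B sAB cA cB sK cK; have [[cA' dA']|[cB' dB']] := place_split sAB (Adj 3 4 isT).
    by apply: (main B A); rewrite 1?sep_sym 1?cut_sym // => q qs; rewrite cut_sym sK.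
  exact: (main A B).
Qed.
End ConfigurationsC.

(** [s1], [s2] and [p1], [p2] are the sizes of the parts of two crossing cuts lying on
    the sides of the other one, [1 + t] that of their common part, which contains x,
    and the [cij] are the sizes of the corners. *)
Lemma corner_arith (s1 s2 p1 p2 t c11 c12 c21 c22 : nat) :
  0 < s1 -> 0 < s2 -> 0 < p1 -> 0 < p2 ->
  s1 + (1 + t) + s2 <= 5 -> p1 + (1 + t) + p2 <= 5 ->
  1 < c11 + p1 + c12 -> 1 < c21 + p2 + c22 ->
  1 < c11 + s1 + c21 -> 1 < c12 + s2 + c22 ->
  14 <= (c11 + p1 + c12) + (s1 + (1 + t) + s2) + (c21 + p2 + c22) ->
  (s1 + t + p1 <= 4 -> c11 <= 1) /\ (s1 + t + p1 <= 3 -> c11 = 0) ->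
  (s2 + t + p1 <= 4 -> c12 <= 1) /\ (s2 + t + p1 <= 3 -> c12 = 0) ->
  (s1 + t + p2 <= 4 -> c21 <= 1) /\ (s1 + t + p2 <= 3 -> c21 = 0) ->
  (s2 + t + p2 <= 4 -> c22 <= 1) /\ (s2 + t + p2 <= 3 -> c22 = 0) ->
  [/\ (c11 + p1 + c12 = 2 \/ c21 + p2 + c22 = 2),
      (c11 + s1 + c21 = 2 \/ c12 + s2 + c22 = 2)
    & c11 + p1 + c12 = 2 -> c11 + s1 + c21 = 2 ->
      [/\ [/\ s1 = 1, p1 = 1 & t <= 1], c12 = 1, c21 = 1,
          s1 + (1 + t) + s2 = 5 & p1 + (1 + t) + p2 = 5]].
Proof.
move=> *; split; [lia | lia | move=> *; repeat split; lia].
Qed.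

(** * Crossing cuts around a square *)

Definition square (G : sgraph) (x a b c d : G) : Prop :=
  [/\ uniq [:: x; a; b; c; d], forall w, adj x w = (w \in [:: a; b; c; d]),
      [/\ adj a b, adj b c, adj c d & adj d a], ~~ adj a c & ~~ adj b d].

Section Square.
Variable G : sgraph.
Hypothesis qG : quasi_connected G 5.
Hypothesis card_G : 14 <= #|G|.
Implicit Types (A B : {set G}).

Lemma square_flip (x a b c d : G) : square x a b c d -> square x c b a d.
Proof.
rewrite /square -[[:: c; b; a; d]]/(rev (rot 3 [:: a; b; c; d])).
case=> u Nx [ab bc cd da] ac bd; split=> //; last by rewrite adj_sym.
- by rewrite cons_uniq mem_rev mem_rot rev_uniq rot_uniq.
- by move=> w; rewrite Nx mem_rev mem_rot.
- by split; rewrite adj_sym.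
Qed.

Lemma square_rot (x a b c d : G) : square x a b c d -> square x b c d a.
Proof.
rewrite /square -[[:: b; c; d; a]]/(rot 1 [:: a; b; c; d]).
case=> u Nx [ab bc cd da] ac bd; split=> //; last by rewrite adj_sym.
- by rewrite cons_uniq mem_rot rot_uniq.
- by move=> w; rewrite Nx mem_rot.
Qed.

(** Otherwise {x, a} is enclosed by b, c, d and the at most one further neighbour of a. *)
Lemma square_deg (x a b c d : G) : square x a b c d -> 4 < deg a.
Proof.
case=> u Nx [ab bc cd da] ac bd; rewrite ltnNge; apply/negP => da4.
pose W := nbhd a :\: [set q in [:: x; b; d]].
have ax : adj a x by rewrite adj_sym Nx !inE eqxx.
have ad : adj a d by rewrite adj_sym.
have uxbd : uniq [:: x; b; d].
  exact: (mask_uniq u [:: true; false; true; false; true]).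
have cW : #|W| <= 1.
  have := cardsID [set q in [:: x; b; d]] (nbhd a); rewrite -/W (setIidPr _); last first.
    by apply/subsetP => q; rewrite !inE => /or3P[]/eqP->.
  rewrite cardsE (card_uniqP uxbd) => e.
  by rewrite -(leq_add2l 3) e.
apply: (@small_boundary G qG card_G [:: x; a] ([:: b; c; d] ++ enum W)) => //.
- exact: (mask_uniq u [:: true; true; false; false; false]).
- rewrite has_sym has_cat negb_or; apply/andP; split.
    have := u; rewrite -[[:: x; a; b; c; d]]/([:: x; a] ++ [:: b; c; d]) cat_uniq.
    by case/and3P.
  apply/hasPn => q; rewrite mem_enum in_setD => /andP[qs qa]; apply/negP.
  rewrite /= !inE => /orP[]/eqP qE; first by move: qs; rewrite qE !inE eqxx.
  by move: qa; rewrite qE inE adj_irr.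
- by rewrite size_cat -cardE /= -[4]/(3 + 1) leq_add2l.
- move=> p w; rewrite mem_seq2 => /orP[]/eqP->.
    rewrite Nx mem_cat mem_seq2 mem_cat !in_cons in_nil !orbF.
    by case/or4P=> ->; rewrite ?orbT.
  move=> aw; rewrite mem_cat mem_seq2 mem_cat mem_enum in_setD inE [w \in nbhd a]inE aw andbT.
  by rewrite !in_cons in_nil !orbF; case: (w == x); case: (w == b); case: (w == d); rewrite ?orbT.
Qed.

(** If x had no neighbour in [B], the cut without x would still separate [B], with at most four
    vertices. *)
Lemma side_nbr A B (x : G) : sep A B -> 1 < #|A| -> 1 < #|B| -> #|cut A B| <= 5 ->
  x \in cut A B -> exists2 q, adj x q & q \in B.
Proof.
move=> sAB cA cB cK xK.
case: (boolP [exists q in B, adj x q]) => [/exists_inP[q qB xq]|]; first by exists q.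
rewrite negb_exists_in => /forall_inP no.
have := sAB => /sepP[dAB _].
have [] := @squeeze G qG B (cut A B :\ x).
- move=> v w vB vw; have := sep_nbr sAB vB vw; rewrite !in_setU in_setD1.
  case: (eqVneq w x) => [wx|//]; have := no v vB; rewrite adj_sym -wx vw.
  by [].
- apply/pred0P => v; rewrite /= in_setD1 in_cut.
  by case: (v \in B); rewrite ?andbF.
- apply: leq_trans cA _; apply/subset_leq_card/subsetP => v vA.
  rewrite in_setC in_setU negb_or in_setD1 in_cut vA andbF andbT.
  by apply/negP => vB; have := pred0P dAB v; rewrite /= vA vB.
- move=> + _; rewrite -ltnS => h; move: cB; rewrite ltnNge h //.
  by have := cardsD1 x (cut A B); rewrite xK; lia.
Qed.

(** Both sides contain a neighbour of x other than a. Among b, c, d only the pair b, d is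
    nonadjacent, so these are separated, and c, adjacent to both, lies in the cut. *)
Lemma square_cut (x a b c d : G) A B : square x a b c d ->
  sep A B -> 1 < #|A| -> 1 < #|B| -> #|cut A B| <= 5 -> x \in cut A B -> a \in cut A B ->
  (b \in A /\ d \in B \/ b \in B /\ d \in A) /\ c \in cut A B.
Proof.
move=> [u Nx [ab bc cd da] ac bd] sAB cA cB cK xK aK.
have [q xq qB] := side_nbr sAB cA cB cK xK.
have [p xp pA] : exists2 p, adj x p & p \in A.
  by apply: (@side_nbr B A); rewrite 1?sep_sym 1?cut_sym.
case/sepP: sAB => dAB nAB; have dis v : v \in A -> v \in B -> False.
  by move=> vA vB; have := pred0P dAB v; rewrite /= vA vB.
have non v w : v \in A -> w \in B -> adj v w -> False.
  by move=> vA wB vw; case/negP: (nAB _ _ vA wB).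
have [aA aB] : a \notin A /\ a \notin B by move: aK; rewrite in_cut => /andP[].
have bdAB : b \in A /\ d \in B \/ b \in B /\ d \in A.
  move: xq xp; rewrite !Nx !in_cons in_nil !orbF.
  case/or4P=> /eqP qE; rewrite {}qE in qB; case/or4P=> /eqP pE; rewrite {}pE in pA;
    first [ by rewrite qB in aB | by rewrite pA in aA | by case: (dis _ pA qB)
          | by case: (non _ _ pA qB) | by case: (non _ _ pA qB); rewrite adj_sym
          | by left | by right].
split=> //; rewrite in_cut; apply/andP; split; apply/negP => cX.
  by case: bdAB => -[bX dX]; [apply: (non c d) | apply: (non c b) => //; rewrite adj_sym].
by case: bdAB => -[bX dX]; [apply: (non b c) | apply: (non d c) => //; rewrite adj_sym].
Qed.

(** All neighbours of x lie in the two cuts, so x has none in the corner and drops out of its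
    boundary. This gain of one is what makes the corners small; x itself and a vertex of [A'] are
    the two vertices left outside. *)
Lemma corner_bound A A' B B' (x : G) : sep A A' -> sep B B' ->
  x \in cut A A' -> x \in cut B B' -> 0 < #|A'| ->
  (forall w, adj x w -> (w \in cut A A') || (w \in cut B B')) ->
  let bound := #|cut A A' :&: B| + #|(cut A A' :&: cut B B') :\ x| + #|cut B B' :&: A| in
  (bound <= 4 -> #|A :&: B| <= 1) /\ (bound <= 3 -> #|A :&: B| = 0).
Proof.
move=> sA sB xS xT /card_gt0P[p pA'] Nx bound; set S := cut A A' in xS Nx bound *.
set T := cut B B' in xT Nx bound *.
pose L := (S :&: B) :|: ((S :&: T) :\ x) :|: (T :&: A).
have cL : #|L| <= bound.
  apply: leq_trans (leq_card_setU _ _) _; rewrite leq_add2r.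
  exact: leq_card_setU.
have [xA xA'] : x \notin A /\ x \notin A' by move: xS; rewrite in_cut => /andP[].
have [xB xB'] : x \notin B /\ x \notin B' by move: xT; rewrite in_cut => /andP[].
have pA : p \notin A.
  by case/sepP: sA => dA _; apply/negP => pA; have := pred0P dA p; rewrite /= pA pA'.
have pS : p \notin S by rewrite in_cut pA' andbF.
have px : x != p by apply: contraNneq xA' => ->.
have [] := @squeeze G qG (A :&: B) L.
- move=> v w /setIP[vA vB] vw.
  have wA : w \in A :|: S by rewrite /S cut_sym; apply: (sep_nbr _ vA vw); rewrite sep_sym.
  have wB : w \in B :|: T by rewrite /T cut_sym; apply: (sep_nbr _ vB vw); rewrite sep_sym.
  have wx : w != x.
    apply/eqP => wx; have := Nx v; rewrite adj_sym -wx vw => /(_ isT).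
    by rewrite /S /T !in_cut vA vB.
  move: wA wB; rewrite !in_setU !in_setI !in_setD1 wx /= in_setI.
  by case: (w \in A); case: (w \in S); case: (w \in B); case: (w \in T).
- apply/pred0P => v; rewrite /= !in_setU !in_setI !in_setD1 in_setI /S /T !in_cut.
  by case: (v \in A); case: (v \in B); rewrite ?andbF.
- apply: leq_trans (_ : #|[set x; p]| <= _); first by rewrite cards2 px.
  apply/subset_leq_card; rewrite subUset !sub1set !in_setC !in_setU !in_setI !in_setD1.
  by rewrite !in_setI (negbTE xA) (negbTE xB) (negbTE pA) (negbTE pS) eqxx /= ?andbF ?orbF.
- by move=> h4 h3; split=> b; [apply: h4 | apply: h3]; apply: leq_trans cL b.
Qed.

Lemma card_split (X B B' : {set G}) : sep B B' ->
  #|X| = #|X :&: B| + #|X :&: cut B B'| + #|X :&: B'|.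
Proof.
move=> /sepP[dB _]; rewrite -(cardsID B X) -addnA; congr (_ + _).
rewrite -(cardsID B' (X :\: B)) addnC; congr (_ + _); apply: eq_card => v.
  by rewrite !in_setD in_setI in_cut; case: (v \in X); case: (v \in B); case: (v \in B').
rewrite in_setI in_setD in_setI; have := pred0P dB v => /=.
by case: (v \in B); case: (v \in X); case: (v \in B').
Qed.

Lemma crossing (x a b c d : G) A A' B B' : square x a b c d ->
  sep A A' -> sep B B' -> 1 < #|A| -> 1 < #|A'| -> 1 < #|B| -> 1 < #|B'| ->
  #|cut A A'| <= 5 -> #|cut B B'| <= 5 ->
  x \in cut A A' -> a \in cut A A' -> c \in cut A A' -> b \in A -> d \in A' ->
  x \in cut B B' -> b \in cut B B' -> d \in cut B B' -> a \in B -> c \in B' ->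
  [/\ #|A| = 2 \/ #|A'| = 2, #|B| = 2 \/ #|B'| = 2
    & #|A| = 2 -> #|B| = 2 ->
      [/\ [/\ #|cut A A' :&: B| = 1, #|cut B B' :&: A| = 1
             & #|(cut A A' :&: cut B B') :\ x| <= 1],
          #|A :&: B'| = 1, #|A' :&: B| = 1, #|cut A A'| = 5 & #|cut B B'| = 5]].
Proof.
move=> [u Nx _ _ _] sA sB cA cA' cB cB' cS cT xS aS cS' bA dA' xT bT dT aB cB''.
have sA' : sep A' A by rewrite sep_sym.
have sB' : sep B' B by rewrite sep_sym.
have NxS w : adj x w -> (w \in cut A A') || (w \in cut B B').
  by rewrite Nx !in_cons in_nil orbF => /or4P[]/eqP->; rewrite ?aS ?bT ?cS' ?dT ?orbT.
have c11 := corner_bound sA sB xS xT (ltnW cA') NxS.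
have c12 : let bound := #|cut A A' :&: B'| + #|(cut A A' :&: cut B B') :\ x| + #|cut B B' :&: A| in
    (bound <= 4 -> #|A :&: B'| <= 1) /\ (bound <= 3 -> #|A :&: B'| = 0).
  rewrite (cut_sym B B'); apply: corner_bound => //; rewrite 1?(cut_sym B' B) //.
  exact: ltnW.
have c21 : let bound := #|cut A A' :&: B| + #|(cut A A' :&: cut B B') :\ x| + #|cut B B' :&: A'| in
    (bound <= 4 -> #|A' :&: B| <= 1) /\ (bound <= 3 -> #|A' :&: B| = 0).
  rewrite (cut_sym A A'); apply: corner_bound => //; rewrite 1?(cut_sym A' A) //.
  exact: ltnW.
have c22 : let bound := #|cut A A' :&: B'| + #|(cut A A' :&: cut B B') :\ x| + #|cut B B' :&: A'| in
    (bound <= 4 -> #|A' :&: B'| <= 1) /\ (bound <= 3 -> #|A' :&: B'| = 0).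
  rewrite (cut_sym A A') (cut_sym B B'); apply: corner_bound => //;
    rewrite 1?(cut_sym A' A) 1?(cut_sym B' B) //.
  exact: ltnW.
have eA := card_split A sB; have eA' := card_split A' sB.
have eB := card_split B sA; have eB' := card_split B' sA.
have eS := card_split (cut A A') sB; have eT := card_split (cut B B') sA.
have eG := card_sep sA.
have eST : #|cut A A' :&: cut B B'| = 1 + #|(cut A A' :&: cut B B') :\ x|.
  by rewrite (cardsD1 x) in_setI xS xT.
have pos (X : {set G}) q : q \in X -> 0 < #|X| by move=> qX; apply/card_gt0P; exists q.
have p1 : 0 < #|cut A A' :&: B| by apply: (pos _ a); rewrite in_setI aS aB.
have p2 : 0 < #|cut A A' :&: B'| by apply: (pos _ c); rewrite in_setI cS' cB''.
have p3 : 0 < #|cut B B' :&: A| by apply: (pos _ b); rewrite in_setI bT bA.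
have p4 : 0 < #|cut B B' :&: A'| by apply: (pos _ d); rewrite in_setI dT dA'.
rewrite [cut B B' :&: cut A A']setIC in eT.
rewrite [B :&: A]setIC [B :&: cut _ _]setIC [B :&: A']setIC in eB.
rewrite [B' :&: A]setIC [B' :&: cut _ _]setIC [B' :&: A']setIC in eB'.
rewrite [A :&: cut _ _]setIC in eA; rewrite [A' :&: cut _ _]setIC in eA'.
rewrite eST in eS eT.
move: c11 c12 c21 c22 => /=; move: eA eA' eB eB' eS eT eG p1 p2 p3 p4.
move=> eA eA' eB eB' eS eT eG p1 p2 p3 p4 c11 c12 c21 c22.
rewrite eA in cA eG *; rewrite eA' in cA' eG *; rewrite eB in cB *; rewrite eB' in cB' *.
rewrite eS in cS eG *; rewrite eT in cT *.
have cG := card_G; rewrite -eG addnAC in cG.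
exact: (corner_arith p1 p2 p3 p4 cS cT cA cA' cB cB' cG c11 c12 c21 c22).
Qed.
End Square.

(** * Naming the vertices around two small sides *)

Section Final.
Variable G : sgraph.
Hypothesis qG : quasi_connected G 5.
Hypothesis card_G : 14 <= #|G|.
Hypothesis no_contractible : forall H : subgraph G,
  1 <= #|sub_edges H| <= 3 -> ~~ quasi_contractible H 5.
Implicit Types (A B : {set G}).

Lemma cut_completion (S : {set G}) (p q r : G) : uniq [:: p; q; r] -> #|S| = 5 ->
  p \in S -> q \in S -> r \in S ->
  exists u v, [/\ u != v, u \in S, v \in S, (u \notin [:: p; q; r]) && (v \notin [:: p; q; r])
                & forall s, s \in S -> s \in [:: p; q; r; u; v]].
Proof.
move=> upqr cS pS qS rS; pose Z := [set s in [:: p; q; r]].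
have ZS : Z \subset S by apply/subsetP => s; rewrite inE mem_seq3 => /or3P[]/eqP->.
have cZ : #|S :\: Z| == 2.
  by rewrite cardsD (setIidPr ZS) cS cardsE (card_uniqP upqr).
have /cards2P[u [v [uv eZ]]] := cZ.
have mem s : (s \in S :\: Z) = (s == u) || (s == v) by rewrite eZ !inE.
have := mem u; have := mem v; rewrite !eqxx orbT !in_setD !inE => /andP[vZ vS] /andP[uZ uS].
exists u, v; split=> //; first by rewrite !inE uZ vZ.
move=> s sS; have := mem s; rewrite in_setD sS andbT [s \in Z]inE !in_cons in_nil !orbF.
by case: (s == p); case: (s == q); case: (s == r) => //= <-.
Qed.

Lemma square_contradiction (x a b c d : G) A A' B B' : square x a b c d ->
  sep A A' -> sep B B' -> 1 < #|A'| -> 1 < #|B'| -> #|A| = 2 -> #|B| = 2 ->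
  #|cut A A'| <= 5 -> #|cut B B'| <= 5 ->
  x \in cut A A' -> a \in cut A A' -> c \in cut A A' -> b \in A -> d \in A' ->
  x \in cut B B' -> b \in cut B B' -> d \in cut B B' -> a \in B -> c \in B' -> False.
Proof.
move=> sq sA sB cA' cB' cA cB cS cT xS aS cS' bA dA' xT bT dT aB cB''.
have [] := crossing qG card_G sq sA sB _ cA' _ cB' cS cT xS aS cS' bA dA' xT bT dT aB cB''.
- by rewrite cA.
- by rewrite cB.
move=> _ _ /(_ cA cB)[[sB1 tA1 st1] c12 c21 cS5 cT5].
have da := square_deg qG card_G sq.
have db := square_deg qG card_G (square_rot sq).
have dc := square_deg qG card_G (square_rot (square_rot sq)).
have dd := square_deg qG card_G (square_rot (square_rot (square_rot sq))).
have /card_gt0P[y /setIP[yA' yB]] : 0 < #|A' :&: B| by rewrite c21.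
have /card_gt0P[t /setIP[tA tB']] : 0 < #|A :&: B'| by rewrite c12.
have [ux Nx [ab bc cd da'] nac nbd] := sq.
have eqmem (X : {set G}) p q : #|X| <= 1 -> p \in X -> q \in X -> p = q.
  by move=> /card_le1_eqP h pX qX; apply: h.
have dA q : q \in A -> q \notin A'.
  by case/sepP: sA => dA _ qA; apply/negP => qA'; have := pred0P dA q; rewrite /= qA qA'.
have dB q : q \in B -> q \notin B'.
  by case/sepP: sB => dB _ qB; apply/negP => qB'; have := pred0P dB q; rewrite /= qB qB'.
have inS q : q \in cut A A' -> q \notin A /\ q \notin A' by rewrite in_cut => /andP[].
have inT q : q \in cut B B' -> q \notin B /\ q \notin B' by rewrite in_cut => /andP[].
pose L := [:: x; a; b; c; d; y; t].
have uL : uniq L.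
  have left1 (X X' : {set G}) (q : G) : q \in X -> place_of X X' q = Some true by rewrite /place_of => ->.
  have right1 q : q \in A' -> place_of A A' q = Some false.
    by move=> qA'; rewrite /place_of qA'; case: ifP => // /dA; rewrite qA'.
  have right2 q : q \in B' -> place_of B B' q = Some false.
    by move=> qB'; rewrite /place_of qB'; case: ifP => // /dB; rewrite qB'.
  (* The seven vertices have seven different pairs of places with respect to the two cuts. *)
  apply: (@map_uniq _ _ (fun q => (place_of A A' q, place_of B B' q))).
  rewrite /= (place_cut xS) (place_cut xT) (place_cut aS) (left1 _ _ _ aB) (left1 _ _ _ bA).
  rewrite (place_cut bT) (place_cut cS') (right2 _ cB'') (right1 _ dA') (place_cut dT).
  by rewrite (right1 _ yA') (left1 _ _ _ yB) (left1 _ _ _ tA) (right2 _ tB').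
have bt : b != t by have := mask_uniq uL [:: false; false; true; false; false; false; true];
  rewrite /= inE andbT.
have ay : a != y by have := mask_uniq uL [:: false; true; false; false; false; true];
  rewrite /= inE andbT.
have xy_t q : q \in [:: y; t] -> ~~ adj q x.
  move=> qyt; have := uL; rewrite -[L]/([:: x; a; b; c; d] ++ [:: y; t]) cat_uniq.
  case/and3P=> _ /hasPn/(_ q qyt) + _; rewrite adj_sym Nx /= inE negb_or.
  by case/andP.
have defA : A = [set b; t] by apply: set2_of_card; rewrite ?cA.
have defB : B = [set a; y] by apply: set2_of_card; rewrite ?cB.
have NA p q : p \in A -> adj p q -> (q \in [:: b; t]) || (q \in cut A A').
  move=> pA pq; have sA1 : sep A' A by rewrite sep_sym.
  by have := sep_nbr sA1 pA pq; rewrite in_setU cut_sym {1}defA in_set2 mem_seq2.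
have NB p q : p \in B -> adj p q -> (q \in [:: a; y]) || (q \in cut B B').
  move=> pB pq; have sB1' : sep B' B by rewrite sep_sym.
  by have := sep_nbr sB1' pB pq; rewrite in_setU cut_sym {1}defB in_set2 mem_seq2.
have nya : ~~ adj y b by case/sepP: sA => _ nA; rewrite adj_sym; apply: nA.
have nta : ~~ adj t a by case/sepP: sB => _ nB; rewrite adj_sym; apply: nB.
pose condS u v := [/\ u != v, u \in cut A A', v \in cut A A', (u \notin L) && (v \notin L)
  & forall s, s \in cut A A' -> s \in [:: x; a; c; u; v]].
pose condT w z := [/\ w != z, w \in cut B B', z \in cut B B', (w \notin L) && (z \notin L)
  & forall s, s \in cut B B' -> s \in [:: x; b; d; w; z]].
have [u [v uvS]] : exists u v, condS u v.
  have uxac : uniq [:: x; a; c] by apply: (mask_uniq uL [:: true; true; false; true]).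
  have [u [v [uv uS vS /andP[un vn] uvS]]] := cut_completion uxac cS5 xS aS cS'.
  have new s : s \in cut A A' -> s \notin [:: x; a; c] -> s \notin L.
    move=> /inS[sA0 sA0']; rewrite !inE !negb_or => /and3P[-> -> ->] /=.
    by apply/and4P; split; [move: sA0 | move: sA0' | move: sA0' | move: sA0];
      apply: contraNneq => ->.
  by exists u, v; split; rewrite ?new.
have [w [z wzT]] : exists w z, condT w z.
  have uxbd : uniq [:: x; b; d] by apply: (mask_uniq uL [:: true; false; true; false; true]).
  have [w [z [wz wT zT /andP[wn zn] wzT]]] := cut_completion uxbd cT5 xT bT dT.
  have new s : s \in cut B B' -> s \notin [:: x; b; d] -> s \notin L.
    move=> /inT[sB0 sB0']; rewrite !inE !negb_or => /and3P[-> -> ->] /=.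
    by apply/and4P; split; [move: sB0 | move: sB0' | move: sB0 | move: sB0'];
      apply: contraNneq => ->.
  by exists w, z; split; rewrite ?new.
have condSC u' v' : condS u' v' -> condS v' u'.
  case=> uv uS vS /andP[un vn] uvS'; split; rewrite 1?eq_sym ?un ?vn // => s /uvS'.
  by rewrite !inE; case: (s == u'); rewrite ?orbT ?orbF.
have condTC w' z' : condT w' z' -> condT z' w'.
  case=> wz wT zT /andP[wn zn] wzT'; split; rewrite 1?eq_sym ?wn ?zn // => s /wzT'.
  by rewrite !inE; case: (s == w'); rewrite ?orbT ?orbF.
have factS u' v' : condS u' v' ->
    [/\ forall q, adj b q -> q \in [:: x; a; c; t; u'; v'],
        forall q, adj t q -> q \in [:: b; c; u'; v']
      & [/\ adj b t, adj c t, adj t u' & adj t v']].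
  case=> _ _ _ _ uvS'.
  have Nb q : adj b q -> q \in [:: x; a; c; t; u'; v'].
    move=> bq; case/orP: (NA _ _ bA bq) => [|/uvS']; rewrite !inE.
      case/orP=> /eqP qE; last by rewrite qE eqxx !orbT.
      by move: bq; rewrite qE adj_irr.
    by case/or4P=> [->|->|->|/orP[]->]; rewrite ?orbT.
  have Nt q : adj t q -> q \in [:: b; c; u'; v'].
    move=> tq; case/orP: (NA _ _ tA tq) => [|/uvS']; rewrite !inE.
      case/orP=> /eqP qE; first by rewrite qE eqxx.
      by move: tq; rewrite qE adj_irr.
    case/or4P=> [/eqP qE|/eqP qE|->|/orP[]->]; rewrite ?orbT //.
      by move: tq; rewrite qE (negbTE (xy_t t _)) // mem_seq2 eqxx orbT.
    by move: tq; rewrite qE (negbTE nta).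
  have full := full_nbhd Nt (deg_ge4 qG card_G t).
  by split=> //; split; rewrite ?full // 1?adj_sym ?full // !inE eqxx ?orbT.
have factT w' z' : condT w' z' ->
    [/\ forall q, adj a q -> q \in [:: x; b; d; y; w'; z'],
        forall q, adj y q -> q \in [:: a; d; w'; z']
      & [/\ adj a y, adj d y, adj y w' & adj y z']].
  case=> _ _ _ _ wzT'.
  have Na q : adj a q -> q \in [:: x; b; d; y; w'; z'].
    move=> aq; case/orP: (NB _ _ aB aq) => [|/wzT']; rewrite !inE.
      case/orP=> /eqP qE; last by rewrite qE eqxx !orbT.
      by move: aq; rewrite qE adj_irr.
    by case/or4P=> [->|->|->|/orP[]->]; rewrite ?orbT.
  have Ny q : adj y q -> q \in [:: a; d; w'; z'].
    move=> yq; case/orP: (NB _ _ yB yq) => [|/wzT']; rewrite !inE.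
      case/orP=> /eqP qE; first by rewrite qE eqxx.
      by move: yq; rewrite qE adj_irr.
    case/or4P=> [/eqP qE|/eqP qE|->|/orP[]->]; rewrite ?orbT //.
      by move: yq; rewrite qE (negbTE (xy_t y _)) // mem_seq2 eqxx.
    by move: yq; rewrite qE (negbTE nya).
  have full := full_nbhd Ny (deg_ge4 qG card_G y).
  by split=> //; split; rewrite ?full // 1?adj_sym ?full // !inE eqxx ?orbT.
have Nx' q : adj x q -> q \in [:: a; b; c; d] by rewrite Nx.
have [xa xb xc xd] : [/\ adj x a, adj x b, adj x c & adj x d].
  by rewrite !Nx !inE !eqxx !orbT.
have ad : adj a d by rewrite adj_sym.
(* The cuts share at most one vertex besides x, so at most one of u, v coincides with one of w, z.
   Such a coincidence is handled here, after exchanging names within the pairs. *)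
have merged u' v' z' : condS u' v' -> condT u' z' -> False.
  move=> hS hT; have [Nb Nt [bt' ct tu tv]] := factS _ _ hS.
  have [Na Ny [ay' dy yw yz]] := factT _ _ hT.
  case: hS => uv uS vS /andP[un vn] _; case: hT => uz uT zT /andP[_ zn] _.
  have ST q : q \in cut A A' -> q \in cut B B' -> q \notin L ->
      q \in (cut A A' :&: cut B B') :\ x.
    by move=> qS qT; rewrite in_setD1 in_setI qS qT /L inE negb_or => /andP[->].
  have vz : v' != z'.
    apply: contraNneq uv => vz; rewrite -vz in zT.
    by apply/eqP/(eqmem _ _ _ st1); apply: ST.
  apply: (@merged_contradiction _ qG card_G no_contractible x a b c d y t u' v' z') => //.
  split=> //.
  - rewrite -[[:: _, _, _, _, _ & _]]/(L ++ [:: u'; v'; z']) cat_uniq uL /= (negbTE un).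
    by rewrite (negbTE vn) (negbTE zn) /= !inE negb_or uv uz vz.
  - move=> e; rewrite !inE; do 15?[case/orP=> [/eqP->//|]]; by move/eqP->.
  - move=> e; rewrite !inE => /or4P[/eqP->|/eqP->|/eqP->|/orP[]/eqP->];
      [exact: Nx' | exact: Na | exact: Nb | exact: Ny | exact: Nt].
have [Nb Nt [bt' ct tu tv]] := factS _ _ uvS.
have [Na Ny [ay' dy yw yz]] := factT _ _ wzT.
have uw : u != w by apply/eqP => uw; apply: (merged w v z); rewrite -?uw // uw.
have uz : u != z.
  by apply/eqP => uz; apply: (merged z v w); [rewrite -uz | apply: condTC].
have vw : v != w.
  by apply/eqP => vw; apply: (merged w u z) => //; apply: condSC; rewrite -vw.
have vz : v != z.
  by apply/eqP => vz; apply: (merged z u w); [apply: condSC; rewrite -vz | apply: condTC].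
case: uvS => uv uS vS /andP[un vn] _; case: wzT => wz wT zT /andP[wn zn] _.
apply: (@base_contradiction _ qG card_G no_contractible x a b c d y t u v w z) => //.
split=> //.
- rewrite -[[:: _, _, _, _, _ & _]]/(L ++ [:: u; v; w; z]) cat_uniq uL /= (negbTE un).
  by rewrite (negbTE vn) (negbTE wn) (negbTE zn) /= !inE !negb_or uv uw uz vw vz wz.
- move=> e; rewrite !inE; do 15?[case/orP=> [/eqP->//|]]; by move/eqP->.
- move=> e; rewrite !inE => /or4P[/eqP->|/eqP->|/eqP->|/orP[]/eqP->];
    [exact: Nx' | exact: Na | exact: Nb | exact: Ny | exact: Nt].
Qed.
End Final.

(** * From the square to the crossing cuts *)

Section NoSquare.
Variable G : sgraph.
Hypothesis qG : quasi_connected G 5.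
Hypothesis card_G : 14 <= #|G|.
Hypothesis no_contractible : forall H : subgraph G,
  1 <= #|sub_edges H| <= 3 -> ~~ quasi_contractible H 5.
Implicit Types (A B : {set G}).

(** The common neighbours of x and a are b and d, of degree at least 5, so contracting xa makes no
    degree too small and must produce a 5-cut through x and a. *)
Lemma square_spoke (x a b c d : G) : square x a b c d ->
  (forall A A', sep A A' -> 1 < #|A| -> 1 < #|A'| -> #|cut A A'| <= 5 ->
     x \in cut A A' -> a \in cut A A' -> c \in cut A A' -> b \in A -> d \in A' -> False) ->
  False.
Proof.
move=> sq noS; have [u Nx [ab bc cd da] nac nbd] := sq.
have db := square_deg qG card_G (square_rot sq).
have dd := square_deg qG card_G (square_rot (square_rot (square_rot sq))).
apply: (@star_obstruction _ qG card_G no_contractible x [:: a]) => //.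
- exact: (mask_uniq u [:: true; true]).
- by move=> q; rewrite Nx mem_seq1 => /eqP->; rewrite !inE eqxx.
- move=> q; rewrite !inE negb_or => /andP[qx qa]; apply: outer_nbhd => /=.
  have d4 := deg_ge4 qG card_G q.
  rewrite adj_sym Nx !inE (negbTE qa) /=.
  case: (eqVneq q b) => [->|qb] /=; first by apply: leq_trans db; case: (adj b a).
  case: (eqVneq q d) => [->|qd] /=; first by rewrite orbT; apply: leq_trans dd; case: (adj d a).
  case: (eqVneq q c) => [->|qc] /=.
    by rewrite [adj c a]adj_sym (negbTE nac); apply: leq_trans (deg_ge4 qG card_G c).
  by apply: leq_trans d4; case: (adj q a).
- move=> A A' sA cA cA' sK cS.
  have xS : x \in cut A A' by apply: sK; rewrite mem_head.
  have aS : a \in cut A A' by apply: sK; rewrite !inE eqxx orbT.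
  have [[[bA dA]|[bA' dA]] cS'] := square_cut qG card_G sq sA cA cA' cS xS aS.
    exact: (noS A A').
  by apply: (noS A' A); rewrite 1?sep_sym 1?(cut_sym A' A).
Qed.

(** The spokes xa and xd give the two crossing cuts. Each has a side with two vertices, and the
    symmetries of the square carry the four choices to the one treated in [square_contradiction]. *)
Lemma no_square (x a b c d : G) : square x a b c d -> False.
Proof.
move=> sq; apply: (square_spoke sq) => A A' sA cA cA' cS xS aS cS' bA dA'.
apply: (square_spoke (square_flip (square_rot sq))) => B' B sB' cB' cB.
rewrite cut_sym sep_sym in sB' * => cT xT dT bT cB'' aB.
have [[A2|A2] [B2|B2] _] := crossing qG card_G sq sA sB' cA cA' cB cB' cS cT
  xS aS cS' bA dA' xT bT dT aB cB''.
- exact: (square_contradiction qG card_G no_contractible sq sA sB').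
- apply: (square_contradiction qG card_G no_contractible (square_flip sq) sA (_ : sep B' B));
    rewrite 1?sep_sym 1?(cut_sym B' B) //.
- apply: (square_contradiction qG card_G no_contractible
    (square_rot (square_rot (square_flip sq))) (_ : sep A' A) sB');
    rewrite 1?sep_sym 1?(cut_sym A' A) //.
- apply: (square_contradiction qG card_G no_contractible
    (square_rot (square_rot sq)) (_ : sep A' A) (_ : sep B' B));
    rewrite 1?sep_sym 1?(cut_sym A' A) 1?(cut_sym B' B) //.
Qed.
End NoSquare.

Lemma cycle4_square (G : sgraph) (x : G) : deg x = 4 ->
  isomorphic (induced (nbhd x)) (cycle_graph 4) -> exists a b c d, square x a b c d.
Proof.
move=> dx [f [g fK gK] fadj].
have ga i j : adj (val (g i)) (val (g j)) = @cycle_adj 4 i j.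
  by rewrite -[LHS](fadj (g i) (g j)) !gK.
pose h i := val (g i); have h_inj : injective h by move=> i j /val_inj/(can_inj gK).
pose o k lt : 'I_4 := @Ordinal 4 k lt.
exists (h (o 0 isT)), (h (o 1 isT)), (h (o 2 isT)), (h (o 3 isT)).
have hx i : adj x (h i) by have := valP (g i); rewrite inE.
have uh : uniq [:: h (o 0 isT); h (o 1 isT); h (o 2 isT); h (o 3 isT)].
  rewrite -[[:: h _; _; _; _]]/(map h [:: o 0 isT; o 1 isT; o 2 isT; o 3 isT]).
  by rewrite (map_inj_uniq h_inj).
have hN w : w \in [:: h (o 0 isT); h (o 1 isT); h (o 2 isT); h (o 3 isT)] -> adj x w.
  by rewrite !inE => /or4P[]/eqP->.
split.
- rewrite cons_uniq uh andbT; apply/negP => /hN.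
  by rewrite adj_irr.
- move=> w; apply/idP/idP => [|/hN//].
  by apply: (nbhd_complete uh hN); rewrite dx.
- by split; rewrite /h ga.
- by rewrite /h ga.
- by rewrite /h ga.
Qed.

Theorem theorem2 (G : sgraph)
    (G_crit : contraction_critically_quasi_connected G 5)
    (G_card : 14 <= #|G|)
    (x : G) (x_deg : x \in Vdeg G 4)
    (x_C4 : isomorphic (induced (nbhd x)) (cycle_graph 4)) :
  exists H : subgraph G,
    quasi_contractible H 5 /\ 1 <= #|sub_edges H| <= 3.
Proof.
have [qG _] := G_crit; have [|a [b [c [d sq]]]] := cycle4_square _ x_C4.
  by move: x_deg; rewrite inE => /eqP.
have ends (E : {set {set G}}) e : e \in E -> e \subset [set: G] by rewrite subsetT.
(* Subgraphs do not form a finite type, but sets of edges do, so existence can be decided on these.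
   The contraction depends only on the edges of the subgraph, hence taking all vertices of [G] is
   harmless. *)
pose contractible (E : {set {set G}}) :=
  if (insub E : option {E : {set {set G}} | E \subset edges G}) is Some EG
  then quasi_contractible (Subgraph (valP EG) (@ends (val EG))) 5 && (1 <= #|val EG| <= 3)
  else false.
case: (boolP [exists E, contractible E]) => [/existsP[E]|].
  rewrite /contractible; case: insub => // EG /andP[qE cE].
  by exists (Subgraph (valP EG) (@ends (val EG))).
rewrite negb_exists => /forallP none; case: (no_square qG G_card _ sq) => H cH.
have := none (sub_edges H); rewrite /contractible (insubT (fun E : {set {set G}} => E \subset edges G) (sub_edgesG H)) /=.
by rewrite cH andbT.
Qed.
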